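(* Let $0<p<1$ be fixed and let $L_n$ be the Laplacian corresponding to an Erdős–Rényi graph $G(n,p)$. There exist constants $C\ge1$ and $c>0$, depending only on $p$, such that for every deterministic $n\times n$ real matrix $F$ and every integer $k$ with $C\log n\le k\le n$, $$\mathbb{P}\left(\sigma_{n-k+1}(L_n+F)\le\frac{ck}{\sqrt n}\right)=O\Big(\exp\big(-\Theta(k^{3/2}/\log n)\big)\Big),$$ where the implied constants depend on $C,c$ (and not on $F$, $k$, $n$).
   Context: For a graph on $n$ vertices with adjacency matrix $A_n=(a_{ij})$, the Laplacian is $L_n=D_n-A_n$, where $D_n=\mathrm{diag}(d_{ii})$ with $d_{ii}=\sum_{j=1}^n a_{ij}$. For an $n\times n$ matrix $X$, the singular values are ordered as $0\le\sigma_n(X)\le\dots\le\sigma_1(X)$, so $\sigma_{n-k+1}(X)$ is the $k$-th smallest singular value. The conclusion means that the probability is at most $K\exp(-\kappa k^{3/2}/\log n)$ for some positive constants $K,\kappa$. *)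

(* Defs.v *)
From mathcomp Require Import all_boot all_order all_algebra.
From mathcomp Require Import all_classical all_reals all_analysis.
From mathcomp.real_closed Require Import polyrcf complex.

Set Implicit Arguments.
Unset Strict Implicit.
Unset Printing Implicit Defensive.

Import Order.TTheory GRing.Theory Num.Theory.
Local Open Scope ring_scope.

(* A simple graph on the vertex set 'I_n is a set of edges, an edge being an
   unordered pair of distinct vertices. *)
Notation edge n := {e : {set 'I_n} | #|e| == 2%N}.
Notation graph n := {set edge n}.

Definition adjacent n (G : graph n) (i j : 'I_n) : bool :=
  [exists e in G, val e == [set i; j]].

Definition adjacency_mx (R : realType) n (G : graph n) : 'M[R]_n :=
  \matrix_(i, j) (adjacent G i j)%:R.

Definition degree_mx (R : realType) n (A : 'M[R]_n) : 'M[R]_n :=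
  diag_mx (\row_i \sum_j A i j).

Definition laplacian (R : realType) n (G : graph n) : 'M[R]_n :=
  degree_mx (adjacency_mx R G) - adjacency_mx R G.

(* The law of G(n, p): each possible edge is present with probability p,
   independently of the others. *)
Definition gnp_mass (R : realType) n (p : R) (G : graph n) : R :=
  \prod_(e : edge n) (if e \in G then p else 1 - p).

Definition gnp_prob (R : realType) n (p : R) (E : pred (graph n)) : R :=
  \sum_(G : graph n | E G) gnp_mass p G.

Lemma gnp_prob_total (R : realType) n (p : R) : gnp_prob p (@predT (graph n)) = 1.
Proof.
rewrite /gnp_prob /gnp_mass.
transitivity (\prod_(e : edge n) (p + (1 - p))).
  rewrite bigA_distr.
  by apply: eq_bigr => G _.
by rewrite big1 // => e _; rewrite addrC subrK.
Qed.

(* The roots of p in R, in increasing order and repeated according to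
   multiplicity. *)
Definition roots_mult (R : realType) (p : {poly R}) : seq R :=
  flatten [seq nseq (mup x p) x | x <- rootsR p].

Definition singular_values (R : realType) n (X : 'M[R]_n) : seq R :=
  sort >=%R [seq Num.sqrt x | x <- roots_mult (char_poly (X^T *m X))].

(* The i-th largest singular value, with i counted from 1. *)
Definition sigma (R : realType) n (i : nat) (X : 'M[R]_n) : R :=
  nth 0 (singular_values X) i.-1.

Lemma roots_mult_prod (R : realType) (s : seq R) :
  perm_eq (roots_mult (\prod_(x <- s) ('X - x%:P))) s.
Proof.
set p := \prod_(x <- s) _.
have p0 : p != 0 by apply: monic_neq0; apply: monic_prod_XsubC.
apply/allP => x _ /=; apply/eqP.
rewrite count_flatten -map_comp /=.
rewrite (eq_map (g := fun y => ((y == x) * mup y p)%N)); last first.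
  by move=> y /=; rewrite count_nseq.
rewrite sumnE big_map -mu_prod_XsubC -/p.
have Ur : uniq (rootsR p) by apply: uniq_roots.
case: (boolP (x \in rootsR p)) => xr.
  rewrite (bigD1_seq x) //= eqxx mul1n big1 ?addn0 // => y /negPf ->.
  by rewrite mul0n.
rewrite big_seq big1 ?mupNroot //.
  by move: xr; rewrite -(roots_on_rootsR p0).
move=> y yr; case: eqP => [yx|]; last by rewrite mul0n.
by rewrite -yx yr in xr.
Qed.

Lemma char_poly_symmetric (R : realType) n (A : 'M[R]_n) : A^T = A ->
  exists2 s : seq R, size s = n & char_poly A = \prod_(x <- s) ('X - x%:P).
Proof.
move=> At; pose i := real_complex R.
pose B : 'M[R[i]]_n := map_mx i A.
have Bsym : B \is symmetricmx.
  apply/is_hermitianmxP; rewrite expr0 scale1r.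
  by apply/matrixP => a b; rewrite !mxE /= -[in LHS]At mxE.
have Breal : B \is a realmx.
  apply/mxOverP => a b; rewrite mxE; apply/CrealP; exact: conjc_real.
have BH := realsym_hermsym Bsym Breal.
have /orthomx_spectralP Beq := hermitian_normalmx BH.
have /mxOverP Dreal := hermitian_spectral_diag_real BH.
pose d := spectral_diag B; pose P := spectralmx B.
exists [seq complex.Re (d 0 j) | j <- enum 'I_n]; first by rewrite size_map size_enum_ord.
apply: (@map_poly_inj _ _ i).
rewrite map_char_poly -/B rmorph_prod big_map big_enum /=.
have Pu : P \in unitmx by apply: spectral_unit.
have -> : char_poly B = char_poly (diag_mx d).
  rewrite /char_poly; pose Q := map_mx (@polyC R[i]) P.
  have Qu : Q \in unitmx by rewrite unitmxE det_map_mx rmorph_unit -?unitmxE.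
  have {1}-> : char_poly_mx B = invmx Q *m char_poly_mx (diag_mx d) *m Q.
    rewrite /char_poly_mx mulmxBr mulmxBl scalar_mxC mulmxKV // {1}Beq.
    by rewrite !map_mxM map_invmx.
  by rewrite !det_mulmx mulrAC -det_mulmx mulVmx // det1 mul1r.
rewrite char_poly_trig ?diag_mx_is_trig //.
apply: eq_bigr => j _.
rewrite !mxE eqxx mulr1n rmorphB /= map_polyX map_polyC /=.
congr (_ - _%:P); have /CrealP := Dreal 0 j.
rewrite -/d; case: (d 0 j) => a b /= [/eqP bE].
by move: bE; rewrite eq_sym -addr_eq0 -mulr2n mulrn_eq0 /= => /eqP ->.
Qed.

Lemma char_poly_gram (R : realType) n (X : 'M[R]_n) :
  exists s : seq R, [/\ size s = n, {in s, forall x, 0 <= x} &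
    char_poly (X^T *m X) = \prod_(x <- s) ('X - x%:P)].
Proof.
have [|s sn sE] := @char_poly_symmetric R n (X^T *m X).
  by rewrite trmx_mul trmxK.
exists s; split=> // x xs.
have : root (char_poly (X^T *m X)) x by rewrite sE root_prod_XsubC.
rewrite -eigenvalue_root_char => /eigenvalueP[v vE v0].
have sq (w : 'rV[R]_n) : (w *m w^T) 0 0 = \sum_j w 0 j ^+ 2.
  by rewrite mxE; apply: eq_bigr => j _; rewrite mxE expr2.
have : (v *m X^T *m (v *m X^T)^T) 0 0 = x * (v *m v^T) 0 0.
  by rewrite trmx_mul trmxK !mulmxA -(mulmxA v) vE -scalemxAl mxE.
rewrite !sq => xE.
have vv : 0 < \sum_j v 0 j ^+ 2.
  rewrite lt_neqAle sumr_ge0 ?andbT; last by move=> j _; rewrite sqr_ge0.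
  apply: contra v0; rewrite eq_sym psumr_eq0; last by move=> j _; rewrite sqr_ge0.
  move=> /allP v0; apply/eqP/rowP => j; rewrite mxE.
  by apply/eqP; rewrite -sqrf_eq0; apply: (v0 j); rewrite mem_index_enum.
rewrite -(pmulr_lge0 _ vv) -xE.
by apply: sumr_ge0 => j _; rewrite sqr_ge0.
Qed.

Lemma singular_valuesP (R : realType) n (X : 'M[R]_n) :
  [/\ size (singular_values X) = n,
      sorted >=%R (singular_values X),
      {in singular_values X, forall s, 0 <= s} &
      char_poly (X^T *m X) =
        \prod_(s <- singular_values X) ('X - (s ^+ 2)%:P)].
Proof.
have [s [sn s0 sE]] := char_poly_gram X.
have sP : perm_eq (singular_values X) [seq Num.sqrt x | x <- s].
  by rewrite /singular_values sE perm_sort perm_map ?roots_mult_prod.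
split.
- by rewrite (perm_size sP) size_map.
- by apply: sort_sorted => x y; apply: le_total.
- by move=> x; rewrite (perm_mem sP) => /mapP[y _ ->]; apply: sqrtr_ge0.
- rewrite (perm_big _ sP) big_map sE big_seq [RHS]big_seq.
  by apply: eq_bigr => x xs; rewrite sqr_sqrtr ?s0.
Qed.

(* Main.v *)
From mathcomp Require Import all_boot all_order all_algebra.
From mathcomp Require Import all_classical all_reals all_analysis.
From mathcomp.real_closed Require Import complex.
From mathcomp Require Import ring lra.
Require Import Defs.
Import Order.TTheory GRing.Theory Num.Theory.
Local Open Scope ring_scope.

Set Implicit Arguments.
Unset Strict Implicit.
Unset Printing Implicit Defensive.

(** Write [X = L + F] and [t = c k / sqrt n], and let [m] be a small multiple of
[k]. The argument gives a bound of the form [exp (- c' k ^ 2)], which implies the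
claim because [k ^ (3/2) / ln n <= k ^ 2 / ln 2].

Suppose that [X] has [k] singular values at most [t]. Then there is a subspace
[U] of dimension [k] with [|X z| <= t |z|] on [U] ([sigma_small_on]). Choosing
[2 m] coordinates [I] for which the Gram determinant of the orthogonal projector
on [U] is largest yields, for each [i] in [I], a vector [z] of [U] that is [1]
at [i], [0] on the rest of [I], and has norm [O (sqrt (n / k))] ([max_volume]).
Let [X'] be [X] with the rows and columns of [I] erased. It still has many small
singular values, hence also a subspace [W] of dimension close to [k] of small
left singular vectors, supported off [I] ([small_on_tr]). Since [X z] is small,
column [i] of [X] is, up to a small error, a combination of the columns of [X'],
so its projection on [W] has norm [O (t |z|) = O (c sqrt k)], for each of the
[2 m] indices [i] ([small_sigma_structure]). Such a projection should have norm
of order [sqrt k], and this for [m] columns at once has probability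
[exp (- c' m k)], which beats the [n ^ (2 m)] choices of [I] as soon as
[k >= C ln n].

The obstacle is that [X'], and hence [W], depends on the columns indexed by [I]
through the degrees on the diagonal. To get round it, pair the elements of [I].
Exchanging the edges [{i, j}] and [{i', j}], for a pair [(i, i')] and a vertex
[j] off [I], keeps the law of the graph ([gnp_mass_swap]) and all the degrees off
[I], so [X'] is unchanged ([minor_swap]). Averaging over all such exchanges of a
given graph, [W] is fixed, while the entries at which the two columns of a pair
disagree are exchanged independently with probability [1/2] ([gnp_prob_swap]).

For a random signed sum [x] of vectors [p_t] with [sum_t <p_t, z>^2 <= |z|^2],
one has [E exp (- |x|^2 / 16) <= exp (- sum_t |p_t|^2 / 32)] ([small_ball]); here
the sum of the [|p_t|^2] is a constant times the sum, over the vertices [j] off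
[I], of the diagonal entry at [j] of the projector on [W] times the number of
pairs that disagree at [j] ([swap_small_ball]). As the diagonal entries are at
most [1] and add up to [dim W], this is of order [m k] unless more than [k / 4]
vertices see too few disagreements, which has probability
[n ^ k exp (- c' m k)] at most ([quiet_prob]). *)

(** * Orthogonal projectors and subspaces on which a matrix is small *)

Definition dot (R : realType) n (u v : 'rV[R]_n) : R := (u *m v^T) 0 0.

Section Dot.
Variables (R : realType) (n : nat).
Implicit Types u v w : 'rV[R]_n.

Lemma dotE u v : dot u v = \sum_j u 0 j * v 0 j.
Proof. by rewrite /dot mxE; apply: eq_bigr => j _; rewrite mxE. Qed.

Lemma dotC u v : dot u v = dot v u.
Proof. by rewrite !dotE; apply: eq_bigr => j _; rewrite mulrC. Qed.

Lemma dotDl u v w : dot (u + v) w = dot u w + dot v w.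
Proof. by rewrite /dot mulmxDl mxE. Qed.

Lemma dotZl a u v : dot (a *: u) v = a * dot u v.
Proof. by rewrite /dot -scalemxAl mxE. Qed.

Lemma dotDr u v w : dot w (u + v) = dot w u + dot w v.
Proof. by rewrite dotC dotDl !(dotC w). Qed.

Lemma dotZr a u v : dot u (a *: v) = a * dot u v.
Proof. by rewrite dotC dotZl dotC. Qed.

Lemma dot_ge0 u : 0 <= dot u u.
Proof. by rewrite dotE; apply: sumr_ge0 => j _; rewrite -expr2 sqr_ge0. Qed.

Lemma dot_eq0 u : (dot u u == 0) = (u == 0).
Proof.
apply/eqP/eqP => [|->]; last by rewrite /dot mul0mx mxE.
rewrite dotE => /eqP; rewrite psumr_eq0 => [/allP u0|j _]; last first.
  by rewrite -expr2 sqr_ge0.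
apply/rowP => j; rewrite mxE; apply/eqP.
by rewrite -sqrf_eq0 expr2; apply: (u0 j); rewrite mem_index_enum.
Qed.

Lemma dot_CS u v : dot u v ^+ 2 <= dot u u * dot v v.
Proof.
have [->|v0] := eqVneq v 0.
  by rewrite /dot trmx0 !mulmx0 !mxE expr0n mulr0.
have vv : 0 < dot v v by rewrite lt_neqAle dot_ge0 eq_sym dot_eq0 v0.
have := dot_ge0 (dot v v *: u - dot u v *: v).
rewrite -scaleNr !(dotDl, dotDr, dotZl, dotZr) (dotC v u).
set a := dot u u; set b := dot u v; set c := dot v v in vv * => h.
have : 0 <= c * (a * c - b ^+ 2).
  by rewrite (le_trans h) // le_eqVlt; apply/orP; left; apply/eqP; ring.
by rewrite pmulr_rge0 // subr_ge0.
Qed.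

(** This turns a bound on [|u|^2] by a multiple of [|u|] into a bound on [|u|]. *)
Lemma dot_self_le u s : 0 <= s -> dot u u ^+ 2 <= s * dot u u -> dot u u <= s.
Proof.
move=> s0 h; have [u0|u0] := eqVneq (dot u u) 0; first by rewrite u0.
by rewrite -(ler_pM2r (x := dot u u)) -?expr2 // lt_neqAle dot_ge0 eq_sym u0.
Qed.

End Dot.

Lemma dot_mulmx (R : realType) m n (u : 'rV[R]_m) (A : 'M[R]_(m, n)) (v : 'rV[R]_n) :
  dot (u *m A) v = dot u (v *m A^T).
Proof. by rewrite /dot trmx_mul trmxK mulmxA. Qed.

(** If [u B B^T = 0] then [|u B|^2 = 0], and over a real field [u B = 0]. *)
Lemma gram_unit (R : realType) r n (B : 'M[R]_(r, n)) :
  row_free B -> B *m B^T \in unitmx.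
Proof.
move=> Bf; rewrite -row_free_unit -kermx_eq0; apply/eqP/row_matrixP => i.
rewrite row0; set u := row i _.
have : u *m (B *m B^T) = 0 by rewrite -row_mul mulmx_ker row0.
rewrite mulmxA => uB; apply/eqP.
have : dot (u *m B) (u *m B) == 0 by rewrite dot_mulmx uB /dot trmx0 mulmx0 mxE.
by rewrite dot_eq0 mulmx_free_eq0.
Qed.

Definition projector (R : realType) n (P : 'M[R]_n) := P^T = P /\ P *m P = P.

(** For a basis [B] of the row space the projector is [B^T (B B^T)^-1 B]. *)
Lemma projector_exists (R : realType) r n (U : 'M[R]_(r, n)) :
  exists P : 'M[R]_n, [/\ projector P, (P :=: U)%MS & \tr P = (\rank U)%:R].
Proof.
move: (row_base U) (row_base_free U) (eq_row_base U) => B Bf BU.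
pose G := B *m B^T; have Gu : G \in unitmx by apply: gram_unit.
have Gt : G^T = G by rewrite trmx_mul trmxK.
exists (B^T *m invmx G *m B); split; first split.
- by rewrite !trmx_mul trmxK trmx_inv Gt mulmxA.
- by rewrite !mulmxA -(mulmxA _ B) -/G mulmxKV.
- apply: (eqmx_trans _ BU).
  apply/eqmxP; rewrite submxMl /=.
  have h : B = B *m (B^T *m invmx G *m B) by rewrite !mulmxA -/G mulmxV // mul1mx.
  by rewrite {1}h; apply: submxMl.
- by rewrite -mulmxA mxtrace_mulC -mulmxA -/G mulVmx // mxtrace1.
Qed.

Section Projector.
Variables (R : realType) (n : nat) (P : 'M[R]_n).
Hypothesis hP : projector P.

Lemma projector_id (z : 'rV_n) : (z <= P)%MS -> z *m P = z.
Proof. by case: hP => _ PP /submxP[D ->]; rewrite -mulmxA PP. Qed.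

Lemma projector_row j : dot (row j P) (row j P) = P j j.
Proof.
case: hP => Pt PP; rewrite dotE -[in RHS]PP mxE; apply: eq_bigr => i _.
by rewrite !mxE -[in X in _ = _ * X]Pt mxE.
Qed.

Lemma projector_diag_ge0 j : 0 <= P j j.
Proof. by rewrite -projector_row dot_ge0. Qed.

(** [P j j] is the squared norm of row [j], one term of which is [P j j ^ 2]. *)
Lemma projector_diag_le1 j : P j j <= 1.
Proof.
have := projector_diag_ge0 j; rewrite le_eqVlt => /orP[/eqP <- //|p0].
rewrite -(ler_pM2l p0) mulr1 -{3}projector_row dotE (bigD1 j) //= !mxE lerDl.
by apply: sumr_ge0 => i _; rewrite -expr2 sqr_ge0.
Qed.

Lemma projector_norm_le (z : 'rV_n) : dot (z *m P) (z *m P) <= dot z z.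
Proof.
case: hP => Pt PP.
have h : dot (z *m P) (z *m P) = dot z (z *m P).
  by rewrite dot_mulmx Pt -mulmxA PP.
have := dot_ge0 (z - z *m P).
rewrite -scaleN1r !(dotDl, dotDr, dotZl, dotZr) (dotC (z *m P) z) h; lra.
Qed.
End Projector.

Definition small_on (R : realType) n r (N : 'M[R]_n) (t : R) (U : 'M[R]_(r, n)) :=
  forall z : 'rV[R]_n, (z <= U)%MS ->
    dot (z *m N) (z *m N) <= t ^+ 2 * dot z z.

Lemma kermx_trK (R : realType) r n (U : 'M[R]_(r, n)) (x : 'rV[R]_n) :
  x *m (kermx U^T)^T = 0 -> (x <= U)%MS.
Proof.
move=> x0; have /eqmxP -> : (U == kermx (kermx U^T)^T)%MS.
  have h : (U <= kermx (kermx U^T)^T)%MS.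
    by apply/sub_kermxP; apply: trmx_inj; rewrite trmx_mul trmxK mulmx_ker trmx0.
  rewrite -(mxrank_leqif_eq h).
  by rewrite mxrank_ker mxrank_tr mxrank_ker mxrank_tr subKn // rank_leq_col.
by apply/sub_kermxP.
Qed.

(** Right and left small singular vectors are equally many, without any
singular value decomposition: if [W] is the orthogonal complement of the image
of [U^perp] under [N], then [w N^T] lies in [U] for [w] in [W], whence
[|w N^T|^2 = <w, w N^T N> <= |w| t |w N^T|]. *)
Lemma small_on_tr (R : realType) r n (N : 'M[R]_n) (t : R) (U : 'M[R]_(r, n)) :
  small_on N t U ->
  exists W : 'M[R]_n, small_on N^T t W /\ (\rank U <= \rank W)%N.
Proof.
move=> hU; exists (kermx (kermx U^T *m N)^T); split; last first.
  rewrite mxrank_ker mxrank_tr (leq_trans _ (leq_sub2l _ (mxrankM_maxl _ _))) //.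
  by rewrite mxrank_ker mxrank_tr subKn // rank_leq_col.
move=> w /sub_kermxP w0; set y := w *m N^T.
have yU : (y <= U)%MS by apply: kermx_trK; rewrite -mulmxA -trmx_mul.
apply: dot_self_le; first by rewrite mulr_ge0 ?sqr_ge0 ?dot_ge0.
have -> : dot y y = dot w (y *m N) by rewrite {1}/y dot_mulmx trmxK.
apply: le_trans (dot_CS _ _) _.
have -> : t ^+ 2 * dot w w * dot w (y *m N) = dot w w * (t ^+ 2 * dot y y).
  by rewrite {3}/y dot_mulmx trmxK mulrCA mulrA.
by apply: ler_wpM2l; rewrite ?dot_ge0 ?hU.
Qed.

(** * Selecting well separated coordinates by maximal volume *)

Section DetRow.
Variables (R : realType) (m : nat) (i : 'I_m).
Implicit Types (A : 'M[R]_m) (c : 'rV[R]_m).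

(** The identity matrix with row [i] replaced by [c]: left multiplication by it
replaces row [i] of a matrix by a combination of its rows. *)
Definition subst_row c : 'M[R]_m := \matrix_(a, b) (if a == i then c 0 b else (a == b)%:R).

Lemma row'_subst_row c : row' i (subst_row c) = row' i 1%:M.
Proof. by apply/matrixP => a b; rewrite !mxE eq_sym (negPf (neq_lift _ _)). Qed.

Lemma eq_cofactor_row (A B : 'M[R]_m) b : row' i A = row' i B -> cofactor A i b = cofactor B i b.
Proof.
have rc M : row' i (col' b M) = col' b (row' i M) by apply/matrixP => u v; rewrite !mxE.
by rewrite /cofactor !rc => ->.
Qed.

Lemma cofactor_id b : cofactor (1%:M : 'M[R]_m) i b = (i == b)%:R.
Proof.
have /matrixP/(_ b i) : \adj (1%:M : 'M[R]_m) = 1%:M by rewrite -[LHS]mul1mx mul_mx_adj det1.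
by rewrite !mxE eq_sym.
Qed.

Lemma det_subst_row c : \det (subst_row c) = c 0 i.
Proof.
rewrite (expand_det_row _ i) (bigD1 i) //= [X in _ + X]big1 => [|b bi].
  by rewrite addr0 (eq_cofactor_row _ (row'_subst_row c)) cofactor_id mxE !eqxx mulr1.
by rewrite (eq_cofactor_row _ (row'_subst_row c)) cofactor_id eq_sym (negPf bi) mulr0.
Qed.

Lemma det_add_delta A a : \det (A + a *: delta_mx i i) = \det A + a * cofactor A i i.
Proof.
have h : row' i (A + a *: delta_mx i i) = row' i A.
  by apply/matrixP => u v; rewrite !mxE eq_sym (negPf (neq_lift _ _)) mulr0 addr0.
rewrite !(expand_det_row _ i) (bigD1 i) //= [in RHS](bigD1 i) //=.
rewrite !(eq_cofactor_row _ h) !mxE !eqxx mulr1 mulrDl -!addrA; congr (_ + _).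
rewrite addrC; congr (_ + _); apply: eq_bigr => b bi.
by rewrite (eq_cofactor_row _ h) !mxE (negPf bi) andbF mulr0 addr0.
Qed.

Lemma cofactor_subst_row c A :
  cofactor (subst_row c *m A *m (subst_row c)^T) i i = cofactor A i i.
Proof.
have rT : row' i (subst_row c *m A) = row' i A.
  by rewrite row'Esub -mul_rowsub_mx -row'Esub row'_subst_row row'Esub mul_rowsub_mx mul1mx.
have cT B : col' i (B *m (subst_row c)^T) = col' i B.
  apply: trmx_inj; rewrite !tr_col' trmx_mul trmxK.
  by rewrite row'Esub -mul_rowsub_mx -row'Esub row'_subst_row row'Esub mul_rowsub_mx mul1mx.
by rewrite /cofactor cT -/(cofactor _ _ _); apply: eq_cofactor_row.
Qed.
End DetRow.

(** The coordinates [f] are those for which the Gram matrix [G] of the rows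
[f 0, ..., f (m - 1)] of [P] has the largest determinant in absolute value; [z]
is the vector dual to row [f i], so that [|z|^2] is the diagonal entry [gamma]
of [G^-1]. Replacing row [f i] by row [j] of [P] multiplies the determinant by
[z_j ^ 2 + gamma |d_j|^2], where [d_j] is the part of row [j] orthogonal to all
the selected rows. By maximality each of these factors is at most [1], and they
add up to [gamma (1 + tr P - m)]. *)
Lemma max_volume (R : realType) n (P : 'M[R]_n) m :
  projector P -> (m <= \rank P)%N ->
  exists f : 'I_m -> 'I_n, injective f /\ forall i, exists z : 'rV[R]_n,
    [/\ (z <= P)%MS, forall a, z 0 (f a) = (a == i)%:R &
        dot z z * (\tr P - m%:R + 1) <= n%:R].
Proof.
move=> hP mP; have [Pt PP] := hP.
pose U (f : {ffun 'I_m -> 'I_n}) := rowsub f P.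
pose G f := U f *m (U f)^T.
pose f0 := [ffun a => maxrankfun P (widen_ord mP a)].
have f0G : G f0 \in unitmx.
  apply: gram_unit; rewrite -kermx_eq0; apply/eqP/row_matrixP => a.
  rewrite row0.
  have : row a (kermx (U f0)) *m U f0 = 0 by rewrite -row_mul mulmx_ker row0.
  move: (row a _) => u.
  have -> : U f0 = rowsub (widen_ord mP) (rowsub (maxrankfun P) P).
    by apply/matrixP => b c; rewrite !mxE ffunE.
  rewrite rowsubE mulmxA => /eqP; rewrite mulmx_free_eq0 ?maxrowsub_free //.
  move/eqP => u0; apply/rowP => b; move/rowP/(_ (widen_ord mP b)) : u0.
  rewrite !mxE (bigD1 b) //= !mxE eqxx mulr1 big1 ?addr0 // => c cb.
  rewrite !mxE; case: eqP => [/(congr1 val) /= h|_]; last by rewrite mulr0.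
  by case/eqP: cb; apply: val_inj.
case: (@arg_maxP _ _ _ f0 predT (fun f => `|\det (G f)|)) => // f _ fmax.
have Gu : G f \in unitmx.
  rewrite unitmxE unitfE -normr_gt0 (lt_le_trans _ (fmax f0 _)) //.
  by rewrite normr_gt0 -unitfE -unitmxE.
have detG : 0 < `|\det (G f)| by rewrite normr_gt0 -unitfE -unitmxE.
have Gt : (G f)^T = G f by rewrite trmx_mul trmxK.
have Git : (invmx (G f))^T = invmx (G f) by rewrite trmx_inv Gt.
have UP g : U g *m P = U g by rewrite mul_rowsub_mx PP.
have PU g : P *m (U g)^T = (U g)^T by rewrite -{1}Pt -trmx_mul UP.
pose D := P - (U f)^T *m invmx (G f) *m U f.
have DU : D *m (U f)^T = 0.
  by rewrite mulmxBl PU -[X in _ - X]mulmxA mulmxKV ?subrr.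
have hD : projector D.
  split; first by rewrite raddfB /= Pt !trmx_mul trmxK Git mulmxA.
  rewrite {2}/D mulmxBr !mulmxA DU !mul0mx subr0.
  by rewrite mulmxBl PP -(mulmxA _ (U f)) UP.
have trD : \tr D = \tr P - m%:R.
  rewrite raddfB /=; congr (_ - _).
  by rewrite -mulmxA mxtrace_mulC -mulmxA mulVmx // mxtrace1.
exists f; split=> [a b fab|i].
  apply/eqP; apply: contraLR Gu => ab; rewrite unitmxE.
  rewrite (determinant_alternate ab) ?unitr0 // => c.
  by rewrite !mxE; apply: eq_bigr => u _; rewrite !mxE fab.
pose x := row i (invmx (G f)) *m U f.
have xP : x *m P = x by rewrite -mulmxA UP.
have xU : x *m (U f)^T = delta_mx 0 i.
  by rewrite -mulmxA -row_mul mulVmx // rowE mulmx1.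
have xx : dot x x = invmx (G f) i i.
  rewrite {1}/x dot_mulmx xU dotE (bigD1 i) //= !mxE !eqxx mulr1 big1 ?addr0 // => b bi.
  by rewrite !mxE (negPf bi) andbF mulr0.
have key j : x 0 j ^+ 2 + dot x x * D j j <= 1.
  pose f' := [ffun a => if a == i then j else f a].
  pose c := row j P *m (U f)^T *m invmx (G f).
  have ci : c 0 i = x 0 j.
    have -> : c = (invmx (G f) *m (U f *m P^T *m delta_mx j 0))^T.
      by rewrite /c rowE !trmx_mul !trmxK Git trmx_delta !mulmxA.
    by rewrite Pt UP mulmxA -colE /x -row_mul mxE [LHS]mxE [RHS]mxE.
  (* Row [j] of [P] is [c *m U f + row j D], and [D] projects on the part of the
     range of [P] orthogonal to the selected rows. *)
  have Uf' : U f' = subst_row i c *m U f + delta_mx i 0 *m row j D.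
    have -> : row j D = row j P - c *m U f.
      by rewrite raddfB /= /c -!row_mul PU.
    apply/row_matrixP => a; rewrite raddfD /= !row_mul row_rowsub ffunE.
    have -> : row a (delta_mx i 0 : 'M[R]_(m, 1)) = (a == i)%:R%:M.
      by apply/rowP => b; rewrite !mxE !ord1 eqxx andbT mulr1n.
    have -> : row a (subst_row i c) = if a == i then c else delta_mx 0 a.
      by apply/rowP => b; rewrite !mxE; case: eqP => _; rewrite ?mxE ?eqxx 1?eq_sym.
    rewrite mul_scalar_mx; case: eqP => _; first by rewrite scale1r addrC subrK.
    by rewrite scale0r addr0 -rowE row_rowsub.
  have Gf' : G f' = subst_row i c *m G f *m (subst_row i c)^T + D j j *: delta_mx i i.
    have UD : U f *m (row j D)^T = 0.
      by apply: trmx_inj; rewrite trmx_mul trmxK -row_mul DU row0 trmx0.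
    have DD : row j D *m (row j D)^T = (D j j)%:M.
      by apply/rowP => b; rewrite !ord1 [RHS]mxE mulr1n -(projector_row hD).
    have -> : G f' = (subst_row i c *m U f + delta_mx i 0 *m row j D) *m
        ((U f)^T *m (subst_row i c)^T + (row j D)^T *m delta_mx 0 i).
      rewrite /G Uf'; congr (_ *m _); apply: trmx_inj; rewrite trmxK [in RHS]raddfD /=.
      by rewrite !trmx_mul !trmxK trmx_delta.
    rewrite mulmxDl !mulmxDr.
    rewrite -!mulmxA (mulmxA (U f) (row j D)^T) UD mul0mx mulmx0 addr0.
    rewrite (mulmxA (row j D) (U f)^T) -row_mul DU row0 mul0mx mulmx0 add0r.
    congr (_ + _); rewrite (mulmxA (row j D)) DD mul_scalar_mx -scalemxAr.
    by rewrite mul_delta_mx.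
  have : `|\det (G f')| <= `|\det (G f)| := fmax f' isT.
  rewrite Gf' det_add_delta cofactor_subst_row.
  rewrite !det_mulmx det_tr det_subst_row ci.
  have -> : cofactor (G f) i i = \det (G f) * dot x x.
    rewrite xx /invmx Gu !mxE mulrA mulfV ?mul1r //.
    by rewrite -normr_gt0.
  have -> : x 0 j * \det (G f) * x 0 j + D j j * (\det (G f) * dot x x)
     = (x 0 j ^+ 2 + dot x x * D j j) * \det (G f) by ring.
  rewrite normrM ger_pMl // ger0_norm // addr_ge0 ?sqr_ge0 //.
  by rewrite mulr_ge0 ?dot_ge0 ?projector_diag_ge0.
exists x; split.
- by rewrite -xP submxMl.
- move=> a; have -> : (a == i)%:R = (x *m (U f)^T) 0 a by rewrite xU mxE eqxx.
  rewrite -[in LHS]xP [LHS]mxE [RHS]mxE; apply: eq_bigr => b _; congr (_ * _).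
  by rewrite -[in LHS]Pt !mxE.
- have -> : n%:R = \sum_(j < n) (1 : R) by rewrite sumr_const card_ord.
  apply: le_trans _ (ler_sum _ (fun j _ => key j)).
  rewrite big_split /= -mulr_sumr -/(\tr D) trD le_eqVlt; apply/orP; left; apply/eqP.
  rewrite mulrDr mulr1 addrC; congr (_ + _); rewrite dotE.
  by apply: eq_bigr => b _; rewrite expr2.
Qed.

(** * Small singular values and subspaces *)

(** The nonzero rows of a diagonal matrix are multiples of basis vectors. *)
Lemma rank_diag_le (F : fieldType) n (d : 'rV[F]_n) :
  (\rank (diag_mx d) <= #|[set j | d 0%R j != 0%R]|)%N.
Proof.
pose S := [set j | d 0%R j != 0%R].
have h : (diag_mx d <= rowsub (enum_val : 'I_#|S| -> 'I_n) 1%:M)%MS.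
  apply/row_subP => j; rewrite row_diag_mx.
  have [->|dj] := eqVneq (d 0 j) 0; first by rewrite scale0r sub0mx.
  have jS : j \in S by rewrite inE.
  apply: scalemx_sub; rewrite -(enum_rankK_in jS jS).
  by rewrite -row1 -row_rowsub row_sub.
by rewrite (leq_trans (mxrankS h)) // rank_leq_row.
Qed.

Section Spectral.
Variable R : realType.
Local Notation i := (real_complex R).
Local Notation "A ^i" := (map_mx i A) (at level 2).

(** The spectral theorem is applied over the complex numbers; the eigenvalues
of a real symmetric matrix are real, the unitary matrix need not be. *)
Lemma symmetric_spectral n (S : 'M[R]_n) : S^T = S ->
  exists (d : 'rV[R]_n) (P : 'M[R[i]]_n),
    P \is unitarymx /\ S^i = invmx P *m diag_mx d^i *m P.
Proof.
move=> St; pose B := S^i.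
have Bsym : B \is symmetricmx.
  apply/is_hermitianmxP; rewrite expr0 scale1r.
  by apply/matrixP => a b; rewrite !mxE /= -[in LHS]St mxE.
have Breal : B \is a realmx.
  by apply/mxOverP => a b; rewrite mxE; apply/CrealP; exact: conjc_real.
have BH := realsym_hermsym Bsym Breal.
have /orthomx_spectralP Beq := hermitian_normalmx BH.
have /mxOverP Dreal := hermitian_spectral_diag_real BH.
exists (map_mx (@complex.Re R) (spectral_diag B)), (spectralmx B).
split; first exact: spectral_unitarymx.
rewrite -/B [LHS]Beq; congr (_ *m diag_mx _ *m _); apply/rowP => j; rewrite !mxE.
have /CrealP := Dreal 0 j.
case: (spectral_diag B 0 j) => a b /= [/eqP bE].
by move: bE; rewrite eq_sym -addr_eq0 -mulr2n mulrn_eq0 /= => /eqP ->.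
Qed.

Lemma char_poly_conj (F : fieldType) n (P D : 'M[F]_n) : P \in unitmx ->
  char_poly (invmx P *m D *m P) = char_poly D.
Proof.
move=> Pu; pose Q := map_mx (@polyC F) P.
have Qu : Q \in unitmx by rewrite unitmxE det_map_mx rmorph_unit -?unitmxE.
rewrite /char_poly; set A := _ *m P.
have -> : char_poly_mx A = invmx Q *m char_poly_mx D *m Q.
  by rewrite /char_poly_mx mulmxBr mulmxBl scalar_mxC mulmxKV // !map_mxM map_invmx.
by rewrite !det_mulmx mulrAC -det_mulmx mulVmx // det1 mul1r.
Qed.

Lemma spectral_char_poly n (S : 'M[R]_n) (d : 'rV[R]_n) (P : 'M[R[i]]_n) :
  P \is unitarymx -> S^i = invmx P *m diag_mx d^i *m P ->
  char_poly S = \prod_j ('X - (d 0 j)%:P).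
Proof.
move=> Pu Se; apply: (@map_poly_inj _ _ i).
rewrite map_char_poly /= Se char_poly_conj ?unitarymx_unit //.
rewrite char_poly_trig ?diag_mx_is_trig // rmorph_prod.
by apply: eq_bigr => j _; rewrite !mxE eqxx mulr1n rmorphB /= map_polyX map_polyC.
Qed.

(** The subspace is the kernel of [q (X^T X)], where [q] is the product of the
[X - x^2] over the singular values [x <= t]. It is defined over the reals, while
its dimension and the bound on it are read off from a complex diagonalization. *)
Lemma sigma_small_on n k (X : 'M[R]_n) (t : R) :
  (0 < n)%N -> (k <= n)%N -> 0 <= t -> sigma (n - k + 1) X <= t ->
  exists U : 'M[R]_n, small_on X^T t U /\ (k <= \rank U)%N.
Proof.
case: n X => // n X _ kn t0.
rewrite /sigma addn1 /=; set s := singular_values X => st.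
have [ss sor s0 cp] := singular_valuesP X; rewrite -/s in ss sor s0 cp.
pose S := X^T *m X; have St : S^T = S by rewrite trmx_mul trmxK.
have [d [P [Pu Se]]] := symmetric_spectral St.
pose q : {poly R} := \prod_(x <- s | x <= t) ('X - (x ^+ 2)%:P).
have sd : perm_eq [seq x ^+ 2 | x <- s] [seq d 0 j | j <- enum 'I_n.+1].
  apply: prod_XsubC_eq; rewrite big_map [RHS]big_map big_enum /= -(spectral_char_poly Pu Se).
  by rewrite -cp.
have qroot x : root q (x ^+ 2) = has (fun y => (y <= t) && (x ^+ 2 == y ^+ 2)) s.
  rewrite /root /q horner_prod prodf_seq_eq0; apply: eq_has => y /=.
  by rewrite !hornerE subr_eq0.
have qd j : root q (d 0 j) -> d 0 j <= t ^+ 2.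
  have : d 0 j \in [seq x ^+ 2 | x <- s].
    by rewrite (perm_mem sd); apply/mapP; exists j; rewrite ?mem_enum.
  case/mapP => x _ ->; rewrite qroot => /hasP[y ys /andP[yt /eqP ->]].
  by rewrite ler_sqr ?nnegrE ?(s0 y).
have cnt : (k <= count [pred x : R | (x <= t)%R] s)%N.
  rewrite -(cat_take_drop (n.+1 - k) s) count_cat (leq_trans _ (leq_addl _ _)) //.
  have : all [pred x | x <= t] (drop (n.+1 - k) s).
    apply/(all_nthP 0) => j; rewrite size_drop nth_drop ltn_subRL => jk.
    apply: le_trans st => /=.
    have tr : transitive (>=%R : rel R) by move=> a b c ab bc; apply: le_trans bc ab.
    apply: (sorted_leq_nth tr (@lexx _ R) 0 sor); rewrite ?inE ?leq_addr //.
    by rewrite (leq_ltn_trans _ jk) ?leq_addr.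
  by rewrite all_count size_drop ss subKn // => /eqP ->.
pose Q := horner_mx S q.
have QE : Q^i = invmx P *m diag_mx (map_mx (horner q) d)^i *m P.
  rewrite map_horner_mx Se horner_mx_uconjC ?unitarymx_unit // horner_mx_diag.
  by congr (_ *m diag_mx _ *m _); apply/rowP => j; rewrite !mxE horner_map.
exists (kermx Q); split; last first.
  rewrite mxrank_ker -(mxrank_map i) /= QE.
  rewrite -{1}(subKn kn) leq_sub2l // mxrankMfree ?row_free_unit ?unitarymx_unit //.
  rewrite (leq_trans (mxrankM_maxr _ _)) // (leq_trans (rank_diag_le _)) //.
  have -> : [set j | (map_mx (horner q) d)^i 0 j != 0] = ~: [set j | root q (d 0 j)].
    by apply/setP => j; rewrite !inE !mxE fmorph_eq0.
  rewrite cardsCs finset.setCK card_ord leq_sub2l // (leq_trans cnt) //.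
  have -> : #|[set j | root q (d 0 j)]| = count (root q) [seq x ^+ 2 | x <- s].
    by rewrite (permP sd) count_map cardsE cardE size_filter enumT; apply: eq_count.
  rewrite count_map (@eq_in_count _ _ [pred x | (x \in s) && (x <= t)]) => [|x /= -> //].
  by apply: sub_count => x /= /andP[xs xt]; rewrite qroot; apply/hasP; exists x; rewrite ?xt ?eqxx.
move=> z /sub_kermxP zQ.
have h : dot (z *m X^T) (z *m X^T) = dot (z *m S) z.
  by rewrite dotC dot_mulmx trmxK -mulmxA dotC.
rewrite h; pose u := z^i *m invmx P.
have uQ j : u 0 j != 0 -> d 0 j <= t ^+ 2.
  move=> uj; apply: qd; rewrite /root.
  have : (u *m diag_mx (map_mx (horner q) d)^i) 0 j = 0.
    have -> : u *m diag_mx (map_mx (horner q) d)^i = (z *m Q)^i *m invmx P.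
      by rewrite map_mxM QE !mulmxA mulmxK ?unitarymx_unit.
    by rewrite zQ map_mx0 mul0mx mxE.
  rewrite mul_mx_diag mxE => /eqP; rewrite mulf_eq0.
  by rewrite (negPf uj) /= !mxE fmorph_eq0.
have uE (e : 'rV[R]_n.+1) : (z^i *m (invmx P *m diag_mx e^i *m P) *m z^i^T) 0 0 =
    \sum_j i (e 0 j) * `|u 0 j| ^+ 2.
  have Pz j : (P *m z^i^T) j 0 = (u 0 j)^*%C.
    rewrite /u (invmx_unitary Pu) mxE [in RHS]mxE rmorph_sum; apply: eq_bigr => a _.
    rewrite !mxE rmorphM /= mulrC; congr (_ * _); last by rewrite conjcK.
    by rewrite /= oppr0.
  rewrite !mulmxA -mulmxA mxE; apply: eq_bigr => j _.
  by rewrite Pz mul_mx_diag mxE -/u normCK mulrAC mulrC !mxE.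
have zS : i (dot (z *m S) z) = \sum_j i (d 0 j) * `|u 0 j| ^+ 2.
  by rewrite -uE -Se map_trmx -!map_mxM mxE.
have zz : i (dot z z) = \sum_j `|u 0 j| ^+ 2.
  have := uE (const_mx 1); rewrite map_const_mx diag_const_mx.
  rewrite mulmx1 mulVmx ?unitarymx_unit // mulmx1 map_trmx -map_mxM mxE => ->.
  by apply: eq_bigr => j _; rewrite mxE mul1r.
have : i (dot (z *m S) z) <= i (t ^+ 2 * dot z z).
  rewrite rmorphM zS /= zz mulr_sumr; apply: ler_sum => j _.
  have [->|uj] := eqVneq (u 0 j) 0; first by rewrite normr0 expr0n /= !mulr0.
  by rewrite ler_wpM2r ?exprn_ge0 ?normr_ge0 // lecR uQ.
by rewrite lecR.
Qed.
End Spectral.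

(** * Columns of a matrix with many small singular values *)

Definition mask_off (R : realType) m n (f : 'I_m -> 'I_n) : 'M[R]_n :=
  diag_mx (\row_j (j \notin codom f)%:R).

(** The rows and columns selected by [f] are set to zero rather than removed,
so that all matrices keep the same size. *)
Definition minor_off (R : realType) m n (f : 'I_m -> 'I_n) (N : 'M[R]_n) :=
  mask_off R f *m N *m mask_off R f.

Section Deterministic.
Variables (R : realType) (n m : nat).
Implicit Types (f : 'I_m -> 'I_n) (N Q : 'M[R]_n).

Lemma mask_off_tr f : (mask_off R f)^T = mask_off R f.
Proof. by rewrite tr_diag_mx. Qed.

Lemma small_on_sub r1 r2 N t (U : 'M[R]_(r1, n)) (V : 'M[R]_(r2, n)) :
  (V <= U)%MS -> small_on N t U -> small_on N t V.
Proof. by move=> VU hU z zV; apply: hU; apply: submx_trans zV VU. Qed.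

Definition supported_off f r (U : 'M[R]_(r, n)) := (U :&: kermx (1%:M - mask_off R f))%MS.

Lemma supported_off_id f r (U : 'M[R]_(r, n)) r' (V : 'M[R]_(r', n)) :
  (V <= supported_off f U)%MS -> V *m mask_off R f = V.
Proof.
rewrite sub_capmx => /andP[_ /sub_kermxP]; rewrite mulmxBr mulmx1 => /eqP.
by rewrite subr_eq0 => /eqP.
Qed.

Lemma rank_supported_off f r (U : 'M[R]_(r, n)) : (\rank U - m <= \rank (supported_off f U))%N.
Proof.
rewrite leq_subLR -(mxrank_mul_ker U (1%:M - mask_off R f)) leq_add2r.
rewrite (leq_trans (mxrankM_maxr _ _)) //.
have -> : 1%:M - mask_off R f = diag_mx (\row_j (j \in codom f)%:R).
  rewrite -diag_const_mx -raddfB; congr diag_mx; apply/rowP => j; rewrite !mxE.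
  by case: (j \in _); rewrite ?subr0 ?subrr.
rewrite (leq_trans (rank_diag_le _)) //.
apply: (@leq_trans (size (codom f))); last by rewrite size_codom card_ord.
rewrite (leq_trans _ (card_size _)) // subset_leq_card //.
by apply/fintype.subsetP => j; rewrite inE mxE; case: (j \in codom f) => //; rewrite eqxx.
Qed.

(** Let [w] be the projection of row [f a] of [N]. As [z] is [1] at [f a] and [0] at
the other selected coordinates, row [f a] is [z N] minus the part of [z N] that
comes from the unselected rows. Pairing with [w], which is supported off the
selected coordinates, gives [|w|^2 = <w, z N> - <w N'^T, z>] with [N'] the minor,
and both terms are at most [t |w| |z|]. *)
Lemma column_projection_le f N Q t r (P : 'M[R]_(r, n)) a z :
  small_on N t P -> (z <= P)%MS -> (forall b, z 0 (f b) = (b == a)%:R) ->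
  projector Q -> Q *m mask_off R f = Q -> small_on (minor_off f N)^T t Q ->
  dot (row (f a) N *m Q) (row (f a) N *m Q) <= 4 * t ^+ 2 * dot z z.
Proof.
move=> hP zP zf hQ QE slQ; have [Qt QQ] := hQ.
set w := row (f a) N *m Q; pose E := mask_off R f.
have wE : w *m E = w by rewrite -mulmxA QE.
have wQ : (w <= Q)%MS by apply: submxMl.
have zE : z = delta_mx 0 (f a) + z *m E.
  rewrite /E /mask_off mul_mx_diag; apply/rowP => j; rewrite !mxE.
  case: (boolP (j \in codom f)) => [/codomP[b ->]|jf] /=; last first.
    rewrite mulr1 (_ : (j == f a) = false) ?add0r //.
    by apply: contraNF jf => /eqP ->; apply: codom_f.
  rewrite mulr0 addr0 zf; case: eqP => [->|ba]; first by rewrite eqxx.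
  case: eqP => // fba; have := zf b; rewrite fba zf eqxx.
  by case: eqP => // _ /eqP; rewrite oner_eq0.
have ww : dot w w = dot w (z *m N) - dot (w *m (minor_off f N)^T) z.
  have -> : dot (w *m (minor_off f N)^T) z = dot w (z *m E *m N).
    rewrite dot_mulmx trmxK /minor_off !mulmxA -/E.
    by rewrite -[in RHS]wE dot_mulmx mask_off_tr.
  rewrite {1}zE mulmxDl dotDr addrK -rowE.
  by rewrite {1}/w dot_mulmx Qt (projector_id hQ wQ) dotC.
apply: dot_self_le; first by rewrite mulr_ge0 ?dot_ge0 // mulr_ge0 ?sqr_ge0.
have h1 := dot_CS w (z *m N); have h2 := dot_CS (w *m (minor_off f N)^T) z.
have h3 := hP _ zP; have h4 := slQ _ wQ.
have h5 := ler_wpM2l (dot_ge0 w) h3; have h6 := ler_wpM2r (dot_ge0 z) h4.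
rewrite {1}ww; have := sqr_ge0 (dot w (z *m N) + dot (w *m (minor_off f N)^T) z).
lra.
Qed.

(** The projector [Q] in the conclusion is quantified twice because in the
probabilistic part it must be a function of the minor alone: one exists, and
whichever one is chosen, the selected columns have small projections. *)
Lemma small_sigma_structure k (X : 'M[R]_n) (t : R) :
  (0 < n)%N -> (k <= n)%N -> (m <= k)%N -> 0 <= t -> sigma (n - k + 1) X <= t ->
  exists f : 'I_m -> 'I_n, [/\ injective f,
    exists Q, [/\ projector Q, Q *m mask_off R f = Q,
      small_on (minor_off f X^T)^T t Q & k%:R - m%:R - m%:R <= \tr Q] &
    forall Q, projector Q -> Q *m mask_off R f = Q -> small_on (minor_off f X^T)^T t Q ->
      forall a, dot (row (f a) X^T *m Q) (row (f a) X^T *m Q) * (k%:R - m%:R + 1)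
         <= 4 * t ^+ 2 * n%:R].
Proof.
move=> n0 kn mk t0 st.
have [U [hU kU]] := sigma_small_on n0 kn t0 st.
have [P [hP PU trP]] := projector_exists U.
have {}hU : small_on X^T t P by apply: small_on_sub hU; rewrite PU.
have kP : (k <= \rank P)%N by rewrite PU.
have [f [finj hz]] := max_volume hP (leq_trans mk kP).
exists f; split=> // [|Q hQ QE slQ a]; last first.
  have [z [zP zf zz]] := hz a.
  have h := column_projection_le hU zP zf hQ QE slQ.
  have hk : k%:R <= \tr P by rewrite trP ler_nat.
  have km : (0 : R) <= k%:R - m%:R + 1 by rewrite addr_ge0 // subr_ge0 ler_nat.
  apply: le_trans (ler_wpM2r km h) _; rewrite -(mulrA _ (dot z z)); apply: ler_wpM2l.
    by rewrite mulr_ge0 ?sqr_ge0.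
  by apply: le_trans zz; apply: ler_wpM2l; rewrite ?dot_ge0 ?lerD2r.
have [|W [hW kW]] := @small_on_tr _ _ _ (minor_off f X^T) t (supported_off f P).
  move=> z zK; have zE := supported_off_id zK.
  have zP : (z <= P)%MS by apply: submx_trans zK (capmxSl _ _).
  rewrite /minor_off !mulmxA zE; apply: le_trans (hU _ zP).
  have [Et EE] : projector (mask_off R f).
    split; first exact: mask_off_tr.
    rewrite mul_mx_diag; apply/matrixP => i j; rewrite !mxE.
    case: eqP => [->|_]; rewrite ?mulr0n ?mul0r // mulr1n.
    by case: (j \in codom f); rewrite ?mulr1 ?mulr0.
  exact: projector_norm_le.
have [Q [hQ QW trQ]] := projector_exists (supported_off f W).
exists Q; split=> //.
- by apply: (@supported_off_id _ _ W); rewrite QW.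
- by apply: small_on_sub hW; rewrite QW capmxSl.
- rewrite trQ; have := rank_supported_off f W; have := rank_supported_off f P.
  rewrite !leq_subLR => h1 h2; rewrite !lerBlDr -!natrD ler_nat.
  apply: (leq_trans kP); apply: (leq_trans h1).
  by rewrite addnC leq_add2r (leq_trans kW) // addnC.
Qed.
End Deterministic.

(** * Small ball estimate for signed sums *)

(** The constant [2] is not optimal, but permits an elementary proof: for
[u <= 1/2] from [exp u <= 1 / (1 - u)], otherwise from [u <= 2 u ^ 2]. *)
Lemma cosh_le (R : realType) (u : R) : (expR u + expR (- u)) / 2 <= expR (2 * u ^+ 2).
Proof.
wlog u0 : u / 0 <= u => [H|].
  have [/H //|u0] := leP 0 u.
  by have := H (- u); rewrite oppr_ge0 sqrrN opprK [expR (- u) + _]addrC; apply; apply: ltW.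
have [u2|u2] := leP (1 / 2) u.
  have h1 : expR (- u) <= expR u by rewrite ler_expR; lra.
  have h2 : expR u <= expR (2 * u ^+ 2) by rewrite ler_expR expr2; nra.
  lra.
have ub (x : R) : x < 1 -> expR x <= (1 - x)^-1.
  move=> x1; rewrite -[x in expR x]opprK expRN lef_pV2 ?posrE ?expR_gt0 ?subr_gt0 //.
  by rewrite (le_trans _ (expR_ge1Dx _)) // addrC.
have h1 := ub u ltac:(lra); have h2 := ub (- u) ltac:(lra).
have h3 := expR_ge1Dx (2 * u ^+ 2).
have a1 : 1 - u != 0 by rewrite gt_eqF //; lra.
have a2 : 1 - - u != 0 by rewrite gt_eqF //; lra.
have a3 : 0 < 1 - u ^+ 2 by rewrite expr2; nra.
have h4 : ((1 - u)^-1 + (1 - - u)^-1) / 2 = (1 - u ^+ 2)^-1.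
  have -> : 1 - u ^+ 2 = (1 - u) * (1 - - u) by ring.
  by field; rewrite a1 a2.
have : (1 - u ^+ 2)^-1 <= 1 + 2 * u ^+ 2.
  rewrite -[leLHS]mul1r ler_pdivrMr //; have := sqr_ge0 u.
  have : u ^+ 2 <= 1 / 4 by rewrite expr2; nra.
  by move: (u ^+ 2) => x; nra.
lra.
Qed.

Section SmallBall.
Variables (R : realType) (V : lmodType R) (T : finType) (ip : V -> V -> R) (p : T -> V).

Definition bilinear_sym (b : V -> V -> R) :=
  (forall x y, b x y = b y x) /\
  (forall a x y z, b (a *: x + y) z = a * b x z + b y z).

Definition sgb (b : bool) : R := if b then 1 else -1.

Definition signed_sum (s : seq T) (tau : {ffun T -> bool}) : V :=
  \sum_(t <- s) sgb (tau t) *: p t.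

Definition flip t (tau : {ffun T -> bool}) : {ffun T -> bool} :=
  [ffun x => tau x (+) (x == t)].

Lemma flipK t : involutive (flip t).
Proof. by move=> tau; apply/ffunP => x; rewrite !ffunE addbK. Qed.

Hypothesis hip : bilinear_sym ip.
Hypothesis p1 : forall t, ip (p t) (p t) <= 1.

Lemma bilinearE b x y a : bilinear_sym b ->
  b (x + a *: y) (x + a *: y) = b x x + 2 * a * b x y + a ^+ 2 * b y y.
Proof.
by case=> bC bl; rewrite addrC bl bC bl (bC _ (a *: y + x)) bl (bC y x); ring.
Qed.

(** The signs are averaged out one at a time. Averaging over the sign of [p] gives
[exp (- b (x, x) - b (p, p)) cosh (2 b (x, p))], which by [cosh_le] is at most
[exp (- b (p, p)) exp (- b' (x, x))] with [b' (x, y) = b (x, y) - 8 b (x, p) b (y, p)].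
So each vector contributes a factor [exp (- b (p, p))] and makes the form smaller.
The form must be kept from degenerating. The function [psi] does this by duality:
[b (y, y) >= 2 <y, z> - psi z] for all [z], and passing from [b] to [b'] adds only
[16 <p, z>^2] to [psi], so that [psi] stays below [32 |z|^2] throughout. Taking
[z = p / 32] gives [b (p, p) >= |p|^2 / 32]. *)
Lemma signs_exp_le (s : seq T) (b : V -> V -> R) (psi : V -> R) v :
  uniq s -> bilinear_sym b -> (forall y, b y y <= ip y y / 16) ->
  (forall y z, 2 * ip y z - psi z <= b y y) ->
  (forall z, psi z + 16 * (\sum_(t <- s) ip (p t) z ^+ 2) <= 32 * ip z z) ->
  \sum_tau expR (- b (v + signed_sum s tau) (v + signed_sum s tau)) <=
  #|{ffun T -> bool}|%:R * expR (- (\sum_(t <- s) ip (p t) (p t) / 32)).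
Proof.
elim: s b psi v => [|t s IH] b psi v /=.
  move=> _ hb b1 b2 psi1; rewrite !big_nil oppr0 expR0 mulr1.
  rewrite -sum1_card natr_sum; apply: ler_sum => tau _.
  rewrite -expR0 ler_expR oppr_le0.
  have [hC hl] := hip; have z0 y : ip 0 y = 0 by have := hl (-1) 0 0 y; rewrite scaler0 addr0; lra.
  have := psi1 0; rewrite big_nil mulr0 z0 mulr0 addr0 => h0.
  by have := b2 (v + signed_sum [::] tau) 0; rewrite hC z0; lra.
move=> /andP[ts us] hb b1 b2 psi1.
pose b' y z := b y z - 8 * b y (p t) * b z (p t).
pose psi' z := psi z + 16 * ip (p t) z ^+ 2.
have bpp : b (p t) (p t) <= 1 / 16 by apply: le_trans (b1 _) _; rewrite ler_wpM2r ?invr_ge0.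
have psi32 z : psi z <= 32 * ip z z.
  apply: le_trans (psi1 z); rewrite lerDl mulr_ge0 // sumr_ge0 // => i _; exact: sqr_ge0.
have bpp0 : ip (p t) (p t) / 32 <= b (p t) (p t).
  have [hC hl] := hip; have hz a y z : ip (a *: y) z = a * ip y z.
    have := hl a y 0 z; rewrite addr0; have := hl (-1) 0 0 z; rewrite scaler0 addr0; lra.
  have e1 : ip (p t) (32^-1 *: p t) = 32^-1 * ip (p t) (p t) by rewrite hC hz.
  have := psi32 (32^-1 *: p t); have := b2 (p t) (32^-1 *: p t).
  rewrite hz e1; lra.
have hb' : bilinear_sym b'.
  case: hb => bC bl; split=> [x y|a x y z]; first by rewrite /b' bC; ring.
  by rewrite /b' !bl; ring.
have b1' y : b' y y <= ip y y / 16.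
  by apply: le_trans (b1 y); rewrite /b' -mulrA -expr2; have := sqr_ge0 (b y (p t)); lra.
have b2' y z : 2 * ip y z - psi' z <= b' y y.
  (* With [u] and [w] as below, the shift [16 (u - w)] along [p t] is the best one
     given [b (p t) (p t) <= 1 / 16]; what is to be shown becomes
     [16 (u - w)^2 + 16 u^2 - 8 w^2 = 8 (2 u - w)^2 >= 0]. *)
  have := b2 (y + (16 * (ip (p t) z - b y (p t))) *: p t) z.
  rewrite bilinearE // [y + _]addrC (proj2 hip) /psi' /b'.
  set u := ip (p t) z; set w := b y (p t) => h.
  have h2 := ler_wpM2l (sqr_ge0 (16 * (u - w))) bpp.
  have := sqr_ge0 (2 * u - w); rewrite !expr2 in h h2 *; lra.
have psi1' z : psi' z + 16 * (\sum_(t <- s) ip (p t) z ^+ 2) <= 32 * ip z z.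
  by apply: le_trans (psi1 z); rewrite /psi' big_cons mulrDr addrA.
rewrite big_cons opprD expRD mulrCA.
apply: le_trans (ler_wpM2l (expR_ge0 _) (IH b' psi' v us hb' b1' b2' psi1')).
rewrite mulr_sumr.
pose F tau a := expR (- b (v + signed_sum s tau + a *: p t) (v + signed_sum s tau + a *: p t)).
have -> : \sum_tau expR (- b (v + signed_sum (t :: s) tau) (v + signed_sum (t :: s) tau)) =
   \sum_tau F tau (sgb (tau t)).
  by apply: eq_bigr => tau _; rewrite /F /signed_sum big_cons addrCA addrC.
have flipF : \sum_tau F tau (sgb (tau t)) = \sum_tau F tau (- sgb (tau t)).
  rewrite (reindex_inj (inv_inj (flipK t))); apply: eq_bigr => tau _.
  have -> : sgb (flip t tau t) = - sgb (tau t).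
    by rewrite ffunE eqxx /sgb; case: (tau t); rewrite ?opprK.
  rewrite /F; have -> // : signed_sum s (flip t tau) = signed_sum s tau.
  apply: eq_big_seq => x xs; rewrite ffunE (_ : (x == t) = false) ?addbF //.
  by apply: contraNF ts => /eqP <-.
rewrite -[leLHS](mulfK (x := 2)) // mulrDr mulr1 {2}flipF -big_split /= mulr_suml.
apply: ler_sum => tau _.
have -> : F tau (sgb (tau t)) + F tau (- sgb (tau t)) = F tau 1 + F tau (-1).
  by rewrite /sgb; case: (tau t); rewrite // opprK addrC.
rewrite /F !bilinearE // expr1n sqrrN expr1n !mul1r; set x := v + _.
rewrite /b'; set B := b x x; set w := b x (p t); set q := b (p t) (p t).
have -> : - (B + 2 * 1 * w + q) = - B - q + - (2 * w) by ring.
have -> : - (B + 2 * -1 * w + q) = - B - q + 2 * w by ring.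
rewrite !(expRD (- B - q)) -mulrDr [expR (- (2 * w)) + _]addrC -(mulrA (expR _)).
apply: le_trans (ler_wpM2l (expR_ge0 _) (cosh_le _)) _.
by rewrite -!expRD ler_expR; rewrite -/q in bpp0; lra.
Qed.

(** The form [b = ip / 16] is dual to [psi z = 16 <z, z>]; the hypothesis on the
vectors leaves room for the other half of [32 <z, z>] in [signs_exp_le]. *)
Lemma small_ball v :
  (forall z, \sum_t ip (p t) z ^+ 2 <= ip z z) -> (forall z, 0 <= ip z z) ->
  \sum_tau expR (- (ip (v + signed_sum (enum T) tau) (v + signed_sum (enum T) tau) / 16)) <=
  #|{ffun T -> bool}|%:R * expR (- (\sum_t ip (p t) (p t) / 32)).
Proof.
move=> h ip0; have [hC hl] := hip.
have := @signs_exp_le (enum T) (fun x y => ip x y / 16) (fun z => 16 * ip z z) v (enum_uniq _).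
rewrite !big_enum; apply => //.
- by split=> [x y|a x y z]; [rewrite hC|rewrite hl; ring].
- move=> y z; have := ip0 (y + (- 16) *: z); rewrite bilinearE //.
  rewrite expr2; lra.
- by move=> z; rewrite big_enum; have := h z; lra.
Qed.
End SmallBall.

(** * Exchanging and resampling edges of a random graph *)

Section Swap.
Variables (n : nat) (T : finType) (h : T * bool -> edge n).
Hypothesis h_inj : injective h.
Implicit Types (tau : {ffun T -> bool}) (G : graph n).

(** Edges come in disjoint pairs [h (t, true)], [h (t, false)], one for each slot
[t]; those of the slots with [tau t] are exchanged. *)
Definition swap_edge tau (e : edge n) : edge n :=
  if [pick x | h x == e] is Some x then h (x.1, x.2 (+) tau x.1) else e.

Lemma swap_edge_slot tau t b : swap_edge tau (h (t, b)) = h (t, b (+) tau t).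
Proof.
rewrite /swap_edge; case: pickP => [x /eqP/h_inj -> //|/(_ (t, b))].
by rewrite eqxx.
Qed.

Lemma swap_edge_out tau e : (forall x, h x != e) -> swap_edge tau e = e.
Proof. by move=> he; rewrite /swap_edge; case: pickP => // x; rewrite (negPf (he x)). Qed.

Lemma swap_edgeK tau : involutive (swap_edge tau).
Proof.
move=> e; case: (pickP (fun x => h x == e)) => [[t b] /eqP <-|he].
  by rewrite !swap_edge_slot addbK.
by rewrite !swap_edge_out // => x; rewrite he.
Qed.

Definition swap tau G : graph n := [set e | swap_edge tau e \in G].

Lemma swapK tau : involutive (swap tau).
Proof. by move=> G; apply/setP => e; rewrite !inE swap_edgeK. Qed.

Lemma gnp_mass_swap (R : realType) (p : R) tau G : gnp_mass p (swap tau G) = gnp_mass p G.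
Proof.
rewrite /gnp_mass (reindex_inj (inv_inj (swap_edgeK tau))).
by apply: eq_bigr => e _; rewrite inE swap_edgeK.
Qed.

(** Since every exchange preserves the law, the probability of [A] is the
average over [tau] of the probability that the exchanged graph is in [A]. *)
Lemma gnp_prob_swap (R : realType) (p B : R) (A : pred (graph n)) :
  0 <= p <= 1 ->
  (forall G, \sum_tau (A (swap tau G))%:R <= #|{ffun T -> bool}|%:R * B) ->
  gnp_prob p A <= B.
Proof.
move=> /andP[p0 p1] hA; rewrite /gnp_prob.
have c0 : (0 : R) < #|{ffun T -> bool}|%:R.
  by rewrite ltr0n; apply/card_gt0P; exists [ffun => true].
have m0 G : 0 <= gnp_mass p G by apply: prodr_ge0 => e _; case: ifP; rewrite ?subr_ge0.
rewrite -(ler_pM2l c0) (_ : _ * _ = \sum_G gnp_mass p G * \sum_tau (A (swap tau G))%:R).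
  apply: le_trans (ler_sum _ (fun G _ => ler_wpM2l (m0 G) (hA G))) _.
  by rewrite -mulr_suml (_ : \sum_i _ = 1) ?mul1r //; apply: gnp_prob_total.
rewrite (eq_bigr _ (fun G _ => mulr_sumr _ _ _ _)) exchange_big /=.
rewrite -sum1_card natr_sum mulr_suml; apply: eq_bigr => tau _.
rewrite mul1r (reindex_inj (inv_inj (swapK tau))) [RHS]big_mkcond /=.
rewrite big_mkcond; apply: eq_bigr => G _; rewrite gnp_mass_swap.
by case: (A _); rewrite ?mulr1 ?mulr0.
Qed.
End Swap.

Section Resample.
Variables (R : realType) (n : nat) (p : R).
Hypothesis (p01 : 0 <= p <= 1).
Implicit Types G : graph n.

Lemma gnp_mass_ge0 G : 0 <= gnp_mass p G.
Proof. by case/andP: p01 => p0 p1; apply: prodr_ge0 => e _; case: ifP; rewrite ?subr_ge0. Qed.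

Lemma gnp_resample (e : edge n) (F : graph n -> R) :
  \sum_G gnp_mass p G * F G =
  \sum_(G : graph n | e \notin G) (\prod_(e' | e' != e) (if e' \in G then p else 1 - p)) *
     ((1 - p) * F G + p * F (e |: G)).
Proof.
rewrite (bigID (fun G : graph n => e \in G)) /=.
rewrite (reindex_onto (fun G => e |: G) (fun G => G :\ e)) /=; last first.
  by move=> G eG; rewrite finset.setD1K.
rewrite (eq_bigl (fun G : graph n => e \notin G)); last first.
  move=> G; rewrite setU11 /=; apply/eqP/idP => [<-|eG]; first by rewrite !inE eqxx.
  by rewrite setU1K.
rewrite -big_split /=; apply: eq_bigr => G eG.
have massE G' : gnp_mass p G' = (if e \in G' then p else 1 - p) *
    \prod_(e' | e' != e) (if e' \in G' then p else 1 - p) by rewrite /gnp_mass (bigD1 e).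
have -> : gnp_mass p (e |: G) =
    p * \prod_(e' | e' != e) (if e' \in G then p else 1 - p).
  rewrite massE setU11; congr (_ * _).
  by apply: eq_bigr => e' e'e; rewrite !inE (negPf e'e).
rewrite massE (negPf eG); move: (\prod_(_ | _) _) => P; ring.
Qed.

(** Given all the other edges, [e] is present with probability [p]; so expectations
can be compared after averaging over the state of [e] alone. *)
Lemma gnp_resample_le (e : edge n) c (F1 F2 : graph n -> R) :
  (forall G, e \notin G ->
    (1 - p) * F1 G + p * F1 (e |: G) <= c * ((1 - p) * F2 G + p * F2 (e |: G))) ->
  \sum_G gnp_mass p G * F1 G <= c * \sum_G gnp_mass p G * F2 G.
Proof.
move=> hF; rewrite !(gnp_resample e) mulr_sumr; apply: ler_sum => G eG.
rewrite mulrCA; apply: ler_wpM2l (hF _ eG); apply: prodr_ge0 => e' _.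
by case/andP: p01 => p0 p1; case: ifP; rewrite ?subr_ge0.
Qed.

Section Disagree.
Variables (T : finType) (h : T * bool -> edge n).
Hypothesis h_inj : injective h.

Definition disagree t G : bool := (h (t, true) \in G) != (h (t, false) \in G).

(** Given the edge [h (t, false)], the edge [h (t, true)] disagrees with it with
probability [p] or [1 - p], hence at least [p (1 - p)]; each slot thus contributes
a factor at most [1 - p (1 - p) / 2]. The edges [h (t, true)] are resampled in
turn. *)
Lemma disagree_exp (s : seq T) : uniq s ->
  \sum_G gnp_mass p G * \prod_(t <- s) expR (- (disagree t G)%:R) <=
  expR (- (p * (1 - p) / 2)) ^+ size s.
Proof.
have [p0 p1] := andP p01.
elim: s => [|t s IH] /=.
  move=> _; rewrite expr0 -[leRHS](gnp_prob_total n p) /gnp_prob.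
  by apply: ler_sum => G _; rewrite big_nil mulr1.
move=> /andP[ts us]; rewrite exprS.
apply: le_trans (ler_wpM2l (expR_ge0 _) (IH us)).
apply: (@gnp_resample_le (h (t, true))) => G eG.
rewrite !big_cons; set e := h (t, true).
have -> : \prod_(x <- s) expR (- (disagree x (e |: G))%:R) =
          \prod_(x <- s) expR (- (disagree x G)%:R) :> R.
  apply: eq_big_seq => x xs; rewrite /disagree !inE /e !(inj_eq h_inj) !xpair_eqE.
  by rewrite (_ : (x == t) = false) //; apply: contraNF ts => /eqP <-.
set P := \prod_(x <- s) _.
have P0 : 0 <= P by apply: prodr_ge0 => x _; apply: expR_ge0.
have e1 : expR (-1) <= 1 / 2 :> R.
  rewrite expRN mul1r lef_pV2 ?posrE ?expR_gt0 //.
  by have := expR_ge1Dx (1 : R); lra.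
have e2 := expR_ge1Dx (- (p * (1 - p) / 2)).
rewrite /disagree !inE (negPf eG) eqxx /=.
have -> : (h (t, false) == e) = false by rewrite /e (inj_eq h_inj) xpair_eqE andbF.
have -> : (1 - p) * P + p * P = P by ring.
have -> : (1 - p) * (expR (- (false != (h (t, false) \in G))%:R) * P) +
   p * (expR (- (true != (h (t, false) \in G))%:R) * P) =
  ((1 - p) * expR (- (false != (h (t, false) \in G))%:R) +
   p * expR (- (true != (h (t, false) \in G))%:R)) * P by ring.
apply: ler_wpM2r => //.
case: (_ \in G) => /=; rewrite oppr0 expR0 mulr1; nra.
Qed.
End Disagree.
End Resample.

(** * Exchanging the edges of paired vertices in the Laplacian *)

Lemma adjacent_edge n (G : graph n) i j (e : edge n) :
  val e = [set i; j] -> adjacent G i j = (e \in G).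
Proof.
move=> eE; apply/existsP/idP => [[e' /andP[e'G /eqP e'E]]|eG].
  by rewrite (_ : e = e') //; apply: val_inj; rewrite eE.
by exists e; rewrite eG eE eqxx.
Qed.

Lemma adjacentC n (G : graph n) i j : adjacent G i j = adjacent G j i.
Proof. by rewrite /adjacent finset.setUC. Qed.

Section Slots.
Variables (n m : nat) (f : 'I_(m + m) -> 'I_n).
Hypothesis f_inj : injective f.
Implicit Types (G : graph n) (j : 'I_n) (l : 'I_m).

(** The two halves of ['I_(m + m)] are matched: the pairs of selected vertices
are [f (side true l)] and [f (side false l)]. *)
Definition side (b : bool) l : 'I_(m + m) := if b then lshift m l else rshift m l.

Lemma side_inj b b' l l' : side b l = side b' l' -> b = b' /\ l = l'.
Proof.
by case: b b' => [] [] /eqP; rewrite /side ?eq_lshift ?eq_rshift ?eq_lrshift ?eq_rlshift // => /eqP.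
Qed.

(** The vertices [j] are taken off the image of [f] so that the edges
[{f a, j}] are distinct for distinct [a] and [j]. *)
Definition slot := {x : 'I_m * 'I_n | x \in [pred y | y.2 \notin codom f]}.

Lemma slot_edge_subproof (x : slot * bool) :
  #|[set f (side x.2 (val x.1).1); (val x.1).2]| == 2%N.
Proof.
case: x => [[[l j] jf] b] /=; rewrite cards2 (_ : (_ == j) = false) //.
by apply: contraTF jf => /eqP <-; rewrite inE /= negbK codom_f.
Qed.

Lemma slot_sum (V : nmodType) (H : 'I_m -> 'I_n -> V) :
  \sum_(t : slot) H (val t).1 (val t).2 = \sum_l \sum_(j | j \notin codom f) H l j.
Proof.
rewrite -(big_sub [pred y : 'I_m * 'I_n | y.2 \notin codom f] (fun y => H y.1 y.2)).
by rewrite pair_big_dep; apply: eq_bigl => y; rewrite inE.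
Qed.

Definition slot_edge (x : slot * bool) : edge n :=
  exist (fun e : {set 'I_n} => #|e| == 2%N) _ (slot_edge_subproof x).

Lemma slot_edge_inj : injective slot_edge.
Proof.
move=> [[[l j] jf] b] [[[l' j'] jf'] b'] /(congr1 val) /= /setP E.
have jE : j = j'.
  have := E j; rewrite !inE eqxx orbT => /esym/orP[/eqP jE|/eqP //].
  by move: jf; rewrite inE /= jE codom_f.
have fE : side b l = side b' l'.
  have := E (f (side b l)); rewrite !inE eqxx => /esym/orP[/eqP/f_inj //|/eqP jE'].
  by move: jf'; rewrite inE /= -jE' codom_f.
have [bE lE] := side_inj fE; subst.
by congr (_, _); apply: val_inj.
Qed.

Local Notation swap := (swap slot_edge).

Lemma adjacent_slot G (t : slot) b :
  adjacent G (f (side b (val t).1)) (val t).2 = (slot_edge (t, b) \in G).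
Proof. exact: adjacent_edge. Qed.

Lemma adjacent_swap_slot tau G (t : slot) b :
  adjacent (swap tau G) (f (side b (val t).1)) (val t).2 =
  adjacent G (f (side (b (+) tau t) (val t).1)) (val t).2.
Proof. by rewrite !adjacent_slot inE (swap_edge_slot slot_edge_inj). Qed.

Lemma adjacent_swap_out tau G i j : i \notin codom f -> j \notin codom f ->
  adjacent (swap tau G) i j = adjacent G i j.
Proof.
move=> fi fj; rewrite /adjacent; apply: eq_existsb => e.
case: eqP => [eE|]; rewrite ?andbF // !andbT inE swap_edge_out // => -[[[l j'] jf] b].
apply/eqP => /(congr1 val); rewrite eE /= => /setP/(_ (f (side b l))).
rewrite !inE eqxx /= => /esym/orP[] /eqP E.
  by rewrite -E codom_f in fi.
by rewrite -E codom_f in fj.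
Qed.

(** An exchange permutes the edges at [j] among themselves. *)
Lemma degree_swap (R : realType) tau G j : j \notin codom f ->
  \sum_i (adjacent (swap tau G) i j)%:R = \sum_i (adjacent G i j)%:R :> R.
Proof.
move=> fj; rewrite !(bigID (fun i => i \notin codom f) xpredT) /=; congr (_ + _).
  by apply: eq_bigr => i fi; rewrite adjacent_swap_out.
have codomE (H : 'I_n -> R) : \sum_(i | ~~ (i \notin codom f)) H i =
    \sum_l (H (f (side true l)) + H (f (side false l))).
  transitivity (\sum_a H (f a)); last by rewrite big_split_ord big_split.
  rewrite -(big_imset H (h := f)) /=; last by move=> a b _ _; apply: f_inj.
  by apply: eq_bigl => i; rewrite negbK; apply/codomP/imsetP => [[a ->]|[a _ ->]]; exists a.
rewrite !codomE; apply: eq_bigr => l _.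
have lj : (l, j) \in [pred y : 'I_m * 'I_n | y.2 \notin codom f] by rewrite inE.
pose t : slot := exist _ (l, j) lj.
have := adjacent_swap_slot tau G t true; have := adjacent_swap_slot tau G t false.
rewrite /= => -> ->; case: (tau t) => //=; exact: addrC.
Qed.

Section Laplacian.
Variables (R : realType) (F : 'M[R]_n).

(** Transposed, so that the columns of [L + F] become rows. *)
Definition shifted_laplacian G := (laplacian R G + F)^T.

Lemma shifted_laplacianE G i j : i != j ->
  shifted_laplacian G i j = F j i - (adjacent G i j)%:R.
Proof.
move=> ij; rewrite !mxE eq_sym (negPf ij) mulr0n sub0r addrC adjacentC.
by [].
Qed.

Lemma minor_swap tau G :
  minor_off f (shifted_laplacian (swap tau G)) = minor_off f (shifted_laplacian G).
Proof.
have minorE (N : 'M[R]_n) i j :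
    minor_off f N i j = (i \notin codom f)%:R * N i j * (j \notin codom f)%:R.
  by rewrite /minor_off /mask_off mul_diag_mx mul_mx_diag !mxE.
apply/matrixP => i j; rewrite !minorE.
case: (boolP (j \in codom f)) => fj; first by rewrite !mulr0.
case: (boolP (i \in codom f)) => fi; first by rewrite !mul0r.
rewrite !mulr1 !mul1r; have [<-|ij] := eqVneq i j; last first.
  by rewrite !shifted_laplacianE // adjacent_swap_out.
rewrite !mxE adjacent_swap_out // eqxx !mulr1n; congr (_ - _ + _).
rewrite (eq_bigr (fun u => (adjacent (swap tau G) u i)%:R)); last by move=> u _; rewrite mxE adjacentC.
by rewrite degree_swap //; apply: eq_bigr => u _; rewrite mxE adjacentC.
Qed.

Definition disagreements G j : nat :=
  \sum_l (adjacent G (f (side true l)) j != adjacent G (f (side false l)) j).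

Lemma disagreements_swap tau G j : j \notin codom f ->
  disagreements (swap tau G) j = disagreements G j.
Proof.
move=> fj; apply: eq_bigr => l _.
have lj : (l, j) \in [pred y : 'I_m * 'I_n | y.2 \notin codom f] by rewrite inE.
pose t : slot := exist _ (l, j) lj.
have := adjacent_swap_slot tau G t true; have := adjacent_swap_slot tau G t false.
by rewrite /= => -> ->; case: (tau t) => //=; rewrite eq_sym.
Qed.

(** At a vertex [j] off the image of [f], the two columns of a pair have entries
[alpha] and [beta], and the first of them becomes
[(alpha + beta) / 2 + sign * (alpha - beta) / 2] after the exchange. The rows on
the left therefore form a signed sum of the matrices with a single nonzero row
[(alpha - beta) / 2 * row j Q], and [small_ball] applies. *)
Lemma swap_small_ball G (Q : 'M[R]_n) : projector Q -> Q *m mask_off R f = Q ->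
  \sum_tau expR (- ((\sum_l
      let w := row (f (side true l)) (shifted_laplacian (swap tau G)) *m Q in dot w w) / 16)) <=
  #|{ffun slot -> bool}|%:R *
    expR (- ((\sum_(j | j \notin codom f) Q j j * (disagreements G j)%:R) / 128)).
Proof.
move=> hQ QE; have [Qt QQ] := hQ.
pose ip (A B : 'M[R]_(m, n)) := \sum_l dot (row l A) (row l B).
pose D (t : slot) : 'M[R]_(m, n) := delta_mx (val t).1 0 *m row (val t).2 Q.
pose al (t : slot) : R := (slot_edge (t, true) \in G)%:R.
pose be (t : slot) : R := (slot_edge (t, false) \in G)%:R.
(* [D t] has row [(val t).2] of [Q] as its row [(val t).1], and zeros elsewhere. *)
pose p t := ((al t - be t) / 2) *: D t.
pose v := \sum_(t : slot) (F (val t).2 (f (side true (val t).1)) - (al t + be t) / 2) *: D t.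
have hip : bilinear_sym ip.
  split=> [A B|a A B C]; first by apply: eq_bigr => l _; rewrite dotC.
  rewrite /ip mulr_sumr -big_split; apply: eq_bigr => l _ /=.
  by rewrite linearP /= dotDl dotZl.
have rowD t l : row l (D t) = ((l == (val t).1)%:R) *: row (val t).2 Q.
  rewrite row_mul (_ : row l _ = (l == (val t).1)%:R%:M) ?mul_scalar_mx //.
  by apply/rowP => a; rewrite !mxE !ord1 eqxx andbT mulr1n.
have ipD t z : ip (D t) z = (row (val t).1 z *m Q) 0 (val t).2.
  rewrite /ip (bigD1 (val t).1) //= rowD eqxx scale1r big1 ?addr0 => [|l lt]; last first.
    by rewrite rowD (negPf lt) dotZl mul0r.
  rewrite dotC dotE mxE; apply: eq_bigr => a _; congr (_ * _).
  by rewrite -[in LHS]Qt !mxE.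
have c2 t : ((al t - be t) / 2) ^+ 2 = (disagree slot_edge t G)%:R / 4.
  by rewrite /disagree /al /be; case: (_ \in G); case: (_ \in G) => /=; rewrite expr2; lra.
have ipZ a A B : ip (a *: A) B = a * ip A B.
  by rewrite /ip mulr_sumr; apply: eq_bigr => l _; rewrite linearZ dotZl.
have ipp t : ip (p t) (p t) = (disagree slot_edge t G)%:R / 4 * Q (val t).2 (val t).2.
  rewrite /p ipZ (proj1 hip) ipZ mulrA -expr2 c2 ipD rowD eqxx scale1r.
  by rewrite -row_mul QQ mxE.
have key tau : (\sum_l
    let w := row (f (side true l)) (shifted_laplacian (swap tau G)) *m Q in dot w w) =
    ip (v + signed_sum p (enum {: slot}) tau) (v + signed_sum p (enum {: slot}) tau).
  rewrite /ip; apply: eq_bigr => l _.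
  have -> : v + signed_sum p (enum {: slot}) tau = \sum_(t : slot)
      shifted_laplacian (swap tau G) (f (side true (val t).1)) (val t).2 *: D t.
    rewrite /signed_sum big_enum /= -big_split; apply: eq_bigr => t _ /=.
    rewrite scalerA -scalerDl; congr (_ *: _); rewrite shifted_laplacianE; last first.
      by apply: contraTneq (valP t) => E; rewrite inE /= -E negbK codom_f.
    have := adjacent_swap_slot tau G t true.
    rewrite [X in _ = X]adjacent_slot /= => ->; rewrite /sgb /al /be.
    by case: (tau t) => /=; lra.
  suff -> : row l (\sum_(t : slot)
      shifted_laplacian (swap tau G) (f (side true (val t).1)) (val t).2 *: D t) =
    row (f (side true l)) (shifted_laplacian (swap tau G)) *m Q by [].
  rewrite linear_sum /=; under eq_bigr do rewrite linearZ /= rowD.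
  rewrite (slot_sum (fun l' j => shifted_laplacian (swap tau G) (f (side true l')) j *:
    ((l == l')%:R *: row j Q))).
  rewrite (bigD1 l) //= [X in _ + X]big1 => [|l' ll']; last first.
    by apply: big1 => j _; rewrite eq_sym (negPf ll') scale0r scaler0.
  rewrite addr0 mulmx_sum_row [RHS](bigID (fun j => j \notin codom f)) /=.
  rewrite [X in _ = _ + X]big1 => [|j]; last first.
    rewrite negbK => fj; rewrite (_ : row j Q = 0) ?scaler0 //.
    rewrite -Qt -QE trmx_mul mask_off_tr Qt row_mul.
    by rewrite row_diag_mx mxE fj scale0r mul0mx.
  by rewrite addr0; apply: eq_bigr => j _; rewrite eqxx scale1r [X in _ = X *: _]mxE.
rewrite (eq_bigr _ (fun tau _ => congr1 (fun x => expR (- (x / 16))) (key tau))).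
have disE (t : slot) : disagree slot_edge t G =
    (adjacent G (f (side true (val t).1)) (val t).2 != adjacent G (f (side false (val t).1)) (val t).2).
  by rewrite !adjacent_slot.
apply: le_trans (small_ball hip _ _ _ _) _ => [t|z|z|].
- rewrite ipp; have := projector_diag_le1 hQ (val t).2; have := projector_diag_ge0 hQ (val t).2.
  by case: (disagree _ _ _) => /=; lra.
- have h (t : slot) : ip (p t) z ^+ 2 <= (row (val t).1 z *m Q) 0 (val t).2 ^+ 2.
    rewrite /p ipZ exprMn c2 ipD; have := sqr_ge0 ((row (val t).1 z *m Q) 0 (val t).2).
    by case: (disagree _ _ _) => /=; lra.
  apply: le_trans (ler_sum _ (fun t _ => h t)) _.
  rewrite (slot_sum (fun l j => (row l z *m Q) 0 j ^+ 2)); apply: ler_sum => l _.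
  apply: le_trans (projector_norm_le hQ _); rewrite dotE [leRHS](bigID (fun j => j \notin codom f)) /=.
  rewrite -[leLHS]addr0; apply: lerD; last by apply: sumr_ge0 => j _; rewrite -expr2 sqr_ge0.
  by apply: ler_sum => j _; rewrite expr2.
- by apply: sumr_ge0 => l _; apply: dot_ge0.
- rewrite le_eqVlt; apply/orP; left; apply/eqP; congr (_ * expR (- _)).
  under eq_bigr do rewrite ipp disE.
  rewrite (slot_sum (fun l j => (adjacent G (f (side true l)) j
     != adjacent G (f (side false l)) j)%:R / 4 * Q j j / 32)) exchange_big /=.
  rewrite mulr_suml; apply: eq_bigr => j _; rewrite /disagreements natr_sum mulr_sumr mulr_suml.
  by apply: eq_bigr => l _; field.
Qed.
End Laplacian.
End Slots.

(** * The two exceptional events *)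

Lemma bin_le_exp n s : ('C(n, s) <= n ^ s)%N.
Proof.
have h : (n ^_ s <= n ^ s)%N.
  by elim: s => // s IH; rewrite ffactnSr expnSr leq_mul // leq_subr.
by rewrite (leq_trans _ h) // -bin_ffact leq_pmulr // fact_gt0.
Qed.

Lemma gnp_probE (R : realType) n (p : R) (E : pred (graph n)) :
  gnp_prob p E = \sum_G gnp_mass p G * (E G)%:R.
Proof.
rewrite /gnp_prob big_mkcond; apply: eq_bigr => G _.
by case: (E G); rewrite ?mulr1 ?mulr0.
Qed.

Lemma gnp_prob_union (R : realType) n (p : R) (I : finType) (P : pred I)
    (E : pred (graph n)) (A : I -> pred (graph n)) : 0 <= p <= 1 ->
  (forall G, E G -> exists2 i, P i & A i G) ->
  gnp_prob p E <= \sum_(i | P i) gnp_prob p (A i).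
Proof.
move=> p01 EA; rewrite gnp_probE (eq_bigr _ (fun i _ => gnp_probE p (A i))).
rewrite exchange_big /=; apply: ler_sum => G _; rewrite -mulr_sumr.
apply: ler_wpM2l; first exact: gnp_mass_ge0.
case: (boolP (E G)) => [/EA[i Pi AiG]|_]; last by apply: sumr_ge0 => i _; exact: ler0n.
by rewrite (bigD1 i) //= AiG lerDl; apply: sumr_ge0 => j _; exact: ler0n.
Qed.

Section Events.
Variables (R : realType) (n m : nat) (p : R) (f : 'I_(m + m) -> 'I_n).
Hypothesis p01 : 0 <= p <= 1.
Hypothesis f_inj : injective f.
Implicit Types G : graph n.
Let delta := p * (1 - p) / 4.

(** At these vertices most exchanges have no effect, so that they contribute
little to the small ball estimate. *)
Definition quiet (a : R) G : {set 'I_n} :=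
  [set j | (j \notin codom f) && ((disagreements f G j)%:R < a)].

(** By Markov's inequality for [exp (- (number of disagreements))]: [delta] is half
of the exponent [p (1 - p) / 2] that [disagree_exp] gains for each slot. *)
Lemma quiet_set_prob (S : {set 'I_n}) : {in S, forall j, j \notin codom f} ->
  gnp_prob p (fun G => S \subset quiet (delta * m%:R) G) <=
  expR (- (delta * m%:R * #|S|%:R)).
Proof.
move=> Sf; rewrite gnp_probE.
pose sq := [seq t : slot f <- enum {: slot f} | (val t).2 \in S].
have sumS (H : 'I_m -> 'I_n -> nat) : (\sum_(t <- sq) H (val t).1 (val t).2 =
    \sum_(j in S) \sum_l H l j)%N.
  rewrite big_filter big_enum_cond big_mkcond /=.
  rewrite (slot_sum f (fun l j => if j \in S then H l j else 0%N)) exchange_big /=.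
  rewrite big_mkcond [RHS]big_mkcond; apply: eq_bigr => j _.
  case: (boolP (j \in S)) => [/Sf -> //|_]; case: (_ \notin _) => //.
  by rewrite big1.
have sz : size sq = (m * #|S|)%N.
  rewrite -sum1_size (sumS (fun _ _ => 1%N)).
  by under eq_bigr do rewrite sum1_card card_ord; rewrite sum_nat_const mulnC.
have pt G : (S \subset quiet (delta * m%:R) G)%:R <=
   expR (delta * m%:R * #|S|%:R) *
   \prod_(t <- sq) expR (- (disagree (slot_edge (f := f)) t G)%:R) :> R.
  case: (boolP (S \subset _)) => SG; last first.
    by rewrite mulr_ge0 ?expR_ge0 // prodr_ge0 // => t _; apply: expR_ge0.
  have -> : \prod_(t <- sq) expR (- (disagree (slot_edge (f := f)) t G)%:R) =
      expR (- (\sum_(t <- sq) disagree (slot_edge (f := f)) t G)%:R) :> R.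
    by rewrite natr_sum -sumrN expR_sum.
  rewrite -expRD -[leLHS]expR0 ler_expR subr_ge0.
  have -> : (\sum_(t <- sq) disagree (slot_edge (f := f)) t G = \sum_(j in S) disagreements f G j)%N.
    rewrite -(sumS (fun l j => adjacent G (f (side true l)) j != adjacent G (f (side false l)) j)).
    by apply: eq_bigr => t _; rewrite !adjacent_slot.
  rewrite natr_sum -sum1_card natr_sum mulr_sumr; apply: ler_sum => j jS.
  rewrite mulr1; apply: ltW.
  by move/fintype.subsetP/(_ _ jS): SG; rewrite inE => /andP[].
apply: le_trans (ler_sum _ (fun G _ => ler_wpM2l (gnp_mass_ge0 p01 G) (pt G))) _.
under eq_bigr do rewrite mulrCA; rewrite -mulr_sumr.
have h := disagree_exp p01 (slot_edge_inj f_inj) (filter_uniq _ (enum_uniq _)) (s := sq).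
apply: le_trans (ler_wpM2l (expR_ge0 _) h) _.
rewrite sz -expRM_natl -expRD ler_expR natrM /delta; lra.
Qed.

Lemma quiet_prob s :
  gnp_prob p (fun G => (s <= #|quiet (delta * m%:R) G|)%N) <=
  n%:R ^+ s * expR (- (delta * m%:R * s%:R)).
Proof.
pose P (S : {set 'I_n}) := (#|S| == s) && [forall j in S, j \notin codom f].
apply: le_trans (@gnp_prob_union _ _ p _ P _ (fun S G => S \subset quiet (delta * m%:R) G) p01 _) _.
  move=> G /=; set B := quiet _ _ => sB.
  pose S := [set x in take s (enum B)].
  have SB : S \subset B.
    by apply/fintype.subsetP => j; rewrite inE => /mem_take; rewrite mem_enum.
  exists S => //; rewrite /P; apply/andP; split.
    rewrite cardsE (card_uniqP _) ?take_uniq ?enum_uniq // size_take -cardE.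
    by move: sB; rewrite leq_eqVlt => /orP[/eqP <-|->]; rewrite ?ltnn.
  by apply/forall_inP => j /(fintype.subsetP SB); rewrite inE => /andP[].
have h S : P S -> gnp_prob p (fun G => S \subset quiet (delta * m%:R) G) <=
    expR (- (delta * m%:R * s%:R)).
  by move=> /andP[/eqP <- /forall_inP Sf]; apply: quiet_set_prob.
apply: le_trans (ler_sum _ h) _; rewrite sumr_const -[_ *+ _]mulr_natl.
apply: ler_wpM2r; first exact: expR_ge0.
rewrite -natrX ler_nat; apply: leq_trans (bin_le_exp n s).
rewrite -[X in 'C(X, s)]card_ord -card_draws; apply: subset_leq_card.
by apply/fintype.subsetP => S /andP[Ss _]; rewrite inE.
Qed.

Variables (F : 'M[R]_n) (t d rho : R) (s : nat).

Definition left_small (N Q : 'M[R]_n) :=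
  [/\ projector Q, Q *m mask_off R f = Q & small_on (minor_off f N)^T t Q].

Definition columns_small G : Prop :=
  let N := shifted_laplacian F G in
  (exists2 Q, left_small N Q & d <= \tr Q) /\
  (forall Q, left_small N Q -> forall l,
     dot (row (f (side true l)) N *m Q) (row (f (side true l)) N *m Q) <= rho).

Definition columns_small_few_quiet G : bool :=
  `[< columns_small G >] && (#|quiet (delta * m%:R) G| <= s)%N.

(** Each quiet vertex costs at most one unit of the trace, since the diagonal
entries of [Q] are at most [1]. *)
Lemma trace_disagreements G Q : projector Q -> Q *m mask_off R f = Q ->
  delta * m%:R * (\tr Q - #|quiet (delta * m%:R) G|%:R) <=
  \sum_(j | j \notin codom f) Q j j * (disagreements f G j)%:R.
Proof.
move=> hQ QE; set a := delta * m%:R.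
have a0 : 0 <= a.
  by case/andP: p01 => p0 p1; rewrite mulr_ge0 // mulr_ge0 ?invr_ge0 // mulr_ge0 // subr_ge0.
have -> : \tr Q = \sum_(j | j \notin codom f) Q j j.
  rewrite /mxtrace (bigID (fun j => j \notin codom f)) /= [X in _ + X]big1 ?addr0 // => j fj.
  by rewrite -QE /mask_off mul_mx_diag !mxE (negPf fj) mulr0.
have -> : #|quiet a G|%:R = \sum_(j | j \notin codom f) ((disagreements f G j)%:R < a)%R%:R :> R.
  by rewrite cardsE -sum1_card natr_sum big_mkcondr; apply: eq_bigr => j _; case: (_ < _).
rewrite -sumrB mulr_sumr; apply: ler_sum => j _.
have := projector_diag_ge0 hQ j; have := projector_diag_le1 hQ j => q1 q0.
have [ja|ja] /= := ltP _ a.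
  apply: (@le_trans _ _ 0); last by rewrite mulr_ge0.
  by apply: mulr_ge0_le0 => //; rewrite subr_le0.
by rewrite subr0 mulrC; apply: ler_wpM2l.
Qed.

(** Along the exchanges of a given graph the minor and the disagreements do not
change, so one projector [Q] serves all of them and [swap_small_ball] applies
with this [Q]. *)
Lemma columns_small_few_quiet_prob :
  gnp_prob p columns_small_few_quiet <=
  expR (m%:R * rho / 16 - delta * m%:R * (d - s%:R) / 128).
Proof.
apply: (gnp_prob_swap (slot_edge_inj f_inj) p01) => G.
(* Unless some exchange of [G] is in the event, there is nothing to prove; and if
   one is, it provides [Q] and the bound on the quiet vertices for all of them. *)
have [[tau0 /andP[/asboolP h0 q0]]|no] :=
    pselect (exists tau, columns_small_few_quiet (swap (slot_edge (f := f)) tau G)); last first.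
  rewrite big1 ?mulr_ge0 ?expR_ge0 // => tau _.
  by case: (boolP (columns_small_few_quiet _)) => // h; case: no; exists tau.
have left_smallE tau Q : left_small (shifted_laplacian F (swap (slot_edge (f := f)) tau G)) Q <->
    left_small (shifted_laplacian F G) Q.
  by rewrite /left_small minor_swap.
have {q0} qG : (#|quiet (delta * m%:R) G| <= s)%N.
  apply: leq_trans q0; apply: subset_leq_card; apply/fintype.subsetP => j.
  by rewrite !inE => /andP[fj]; rewrite disagreements_swap ?fj.
have {h0} [Q [/left_smallE hQ trQ]] : exists Q,
    left_small (shifted_laplacian F (swap (slot_edge (f := f)) tau0 G)) Q /\ d <= \tr Q.
  by case: h0 => [[Q hQ dQ] _]; exists Q.
have [Qp QE Qs] := hQ.
have pt tau : (columns_small_few_quiet (swap (slot_edge (f := f)) tau G))%:R <=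
    expR (m%:R * rho / 16) * expR (- ((\sum_l
      let w := row (f (side true l)) (shifted_laplacian F (swap (slot_edge (f := f)) tau G)) *m Q
      in dot w w) / 16)).
  case: (boolP (columns_small_few_quiet _)) => [/andP[/asboolP[_ h] _]|_]; last first.
    by rewrite mulr_ge0 ?expR_ge0.
  rewrite -expRD -[leLHS]expR0 ler_expR subr_ge0 ler_pM2r ?invr_gt0 //.
  have -> : m%:R * rho = \sum_(l < m) rho by rewrite sumr_const card_ord mulr_natl.
  by apply: ler_sum => l _; apply: h; apply/left_smallE.
apply: le_trans (ler_sum _ (fun tau _ => pt tau)) _; rewrite -mulr_sumr.
apply: le_trans (ler_wpM2l (expR_ge0 _) (swap_small_ball f_inj F G Qp QE)) _.
rewrite mulrCA; apply: ler_wpM2l => //; rewrite -expRD ler_expR lerD2l lerN2.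
rewrite ler_pM2r ?invr_gt0 //; apply: le_trans (trace_disagreements G Qp QE).
apply: ler_wpM2l.
  by case/andP: p01 => ? ?; rewrite mulr_ge0 // mulr_ge0 ?invr_ge0 // mulr_ge0 // subr_ge0.
by apply: lerB => //; rewrite ler_nat.
Qed.
End Events.

(** * Union bound and choice of the constants *)

Lemma ln2_ge (R : realType) : 1 / 2 <= ln (2 : R).
Proof.
have h : expR (1 / 2) <= (2 : R).
  rewrite -[1 / 2]opprK expRN -[leRHS]invrK lef_pV2 ?posrE ?expR_gt0 ?invr_gt0 //.
  by have := expR_ge1Dx (- (1 / 2) : R); lra.
by rewrite -ler_expR lnK ?posrE.
Qed.

Lemma quotient_bounds k : (16 <= k)%N ->
  [/\ (k %/ 16 * 16 <= k)%N, (k <= k %/ 16 * 32)%N, (k %/ 4 * 4 <= k)%N,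
      (k <= (k %/ 4).+1 * 4)%N & (k %/ 16 + k %/ 16 <= k)%N].
Proof.
move=> k16; have q1 : (0 < k %/ 16)%N by rewrite divn_gt0.
split; rewrite ?leq_trunc_div //.
- apply: leq_trans (ltnW (ltn_ceil k (d := 16) isT)) _.
  by rewrite (_ : 32 = 2 * 16)%N // mulnA leq_mul2r muln2 -addnn -[X in (X <= _)%N]addn1 leq_add2l.
- by apply: ltnW; apply: ltn_ceil.
- rewrite addnn -muln2; apply: leq_trans (leq_trunc_div k 16).
  by rewrite leq_mul2l orbT.
Qed.

Section Union.
Variables (R : realType) (p : R) (n m k : nat) (F : 'M[R]_n) (t rho : R) (s : nat).
Hypotheses (p01 : 0 <= p <= 1) (n0 : (0 < n)%N) (kn : (k <= n)%N) (mk : (m + m <= k)%N).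
Hypothesis t0 : 0 <= t.
Hypothesis rhoE : 4 * t ^+ 2 * n%:R <= rho * (k%:R - (m + m)%:R + 1).

(** The factor [n ^ (2 m)] counts the choices of the selected vertices. *)
Lemma small_sigma_prob :
  gnp_prob p (fun G : graph n => sigma (n - k + 1) (laplacian R G + F) <= t) <=
  n%:R ^+ (m + m) *
  (expR (m%:R * rho / 16 - p * (1 - p) / 4 * m%:R *
      (k%:R - (m + m)%:R - (m + m)%:R - s%:R) / 128)
   + n%:R ^+ s.+1 * expR (- (p * (1 - p) / 4 * m%:R * s.+1%:R))).
Proof.
pose a : R := p * (1 - p) / 4 * m%:R.
pose d : R := k%:R - (m + m)%:R - (m + m)%:R.
pose A (x : {ffun 'I_(m + m) -> 'I_n} * bool) : pred (graph n) :=
  if x.2 then columns_small_few_quiet p x.1 F t d rho s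
  else fun G => (s.+1 <= #|quiet x.1 a G|)%N.
pose inj (x : {ffun 'I_(m + m) -> 'I_n} * bool) := injectiveb x.1.
apply: le_trans (@gnp_prob_union _ _ p _ inj _ A p01 _) _.
  move=> G st.
  have [f [finj exQ allQ]] := small_sigma_structure n0 kn mk t0 st.
  have fE : (finfun f : 'I_(m + m) -> 'I_n) = f by apply/funext => i; rewrite ffunE.
  have injf : injectiveb (finfun f) by apply/injectiveP; rewrite fE.
  have [q|q] := leqP #|quiet f a G| s; last first.
    by exists (finfun f, false); rewrite // /A /= fE.
  exists (finfun f, true); rewrite // /A /= /columns_small_few_quiet fE q andbT.
  apply/asboolP; split.
    by case: exQ => Q [hQ QE slQ dQ]; exists Q.
  move=> Q [hQ QE slQ] l.
  have K0 : (0 : R) < k%:R - (m + m)%:R + 1 by rewrite ltr_wpDl // subr_ge0 ler_nat.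
  by rewrite -(ler_pM2r K0); apply: le_trans rhoE; apply: allQ.
have -> : \sum_(x | inj x) gnp_prob p (A x) =
    \sum_(f : {ffun 'I_(m + m) -> 'I_n} | injectiveb f) \sum_b gnp_prob p (A (f, b)).
  by rewrite [RHS]pair_big_dep; apply: eq_big => [x|[f b] _] //; rewrite /inj andbT.
set B := (X in _ * X); have B0 : 0 <= B.
  by rewrite addr_ge0 ?expR_ge0 // mulr_ge0 ?expR_ge0 // exprn_ge0.
apply: (@le_trans _ _ (\sum_(f : {ffun 'I_(m + m) -> 'I_n} | injectiveb f) B)).
  apply: ler_sum => f /injectiveP finj; rewrite big_bool /=; apply: lerD.
    exact: columns_small_few_quiet_prob.
  exact: quiet_prob.
apply: le_trans (_ : \sum_(f : {ffun 'I_(m + m) -> 'I_n}) B <= _).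
  by rewrite [leLHS]big_mkcond; apply: ler_sum => f _; case: ifP.
by rewrite sumr_const card_ffun !card_ord -[_ *+ _]mulr_natl natrX.
Qed.
End Union.

(** This is where the quadratic exponent is weakened to the stated one. *)
Lemma powR_div_ln_le (R : realType) (x L : R) : 1 <= x -> ln 2 <= L ->
  ln 2 * (x `^ (3 / 2) / L) <= x ^+ 2.
Proof.
move=> x1 L2; have := ln2_ge R => l2.
have L0 : 0 < L by lra.
have x32 : x `^ (3 / 2) <= x ^+ 2.
  by rewrite -powR_mulrn; [apply: ler_powR; lra | lra].
rewrite mulrA ler_pdivrMr // mulrC; apply: ler_pM => //; [exact: powR_ge0 | lra].
Qed.

Lemma rho_bound (R : realType) (delta x m : R) : 0 < delta -> 16 <= x -> m * 16 <= x ->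
  4 * (delta / 512 * x ^+ 2) <= delta * x / 64 * (x - (m + m) + 1).
Proof.
move=> d0 x0 m1; have h : x / 2 <= x - (m + m) + 1 by lra.
have x1 : 0 <= x by lra.
have h2 : 0 <= delta * x / 64 by apply: divr_ge0 => //; apply: mulr_ge0 (ltW d0) x1.
by apply: le_trans (ler_wpM2l h2 h); rewrite expr2; lra.
Qed.

Lemma small_ball_exponent (R : realType) (delta x m s : R) :
  0 < delta -> 0 <= m -> m * 16 <= x -> s * 4 <= x ->
  m * (delta * x / 64) / 16 - delta * m * (x - (m + m) - (m + m) - s) / 128
  <= - (m * delta * x / 1024).
Proof.
move=> d0 m0 m1 s1; have h : x / 2 <= x - (m + m) - (m + m) - s by lra.
have := ler_wpM2l (mulr_ge0 m0 (ltW d0)) h.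
have := mulr_ge0 (mulr_ge0 m0 (ltW d0)) (_ : 0 <= x); lra.
Qed.

Lemma quiet_exponent (R : realType) (delta L x m s : R) :
  0 < delta -> 4096 * L <= delta * x -> 0 <= m -> x <= m * 32 -> x <= (s + 1) * 4 ->
  0 <= s -> 0 <= x ->
  (s + 1) * L - delta * m * (s + 1) <= - (m * delta * x / 1024).
Proof.
move=> d0 Lx m0 m2 s2 s0 x0.
have a1 : L <= m * delta / 2.
  have := ler_wpM2l (ltW d0) m2; have := mulr_ge0 m0 (ltW d0); lra.
have a2 : 0 <= s + 1 by lra.
have := mulr_ge0 (mulr_ge0 m0 (ltW d0)) x0.
have := ler_wpM2l a2 a1; have := ler_wpM2l (mulr_ge0 m0 (ltW d0)) s2; lra.
Qed.

Lemma union_exponent (R : realType) (delta L x m : R) :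
  0 < delta -> 4096 * L <= delta * x -> 0 <= m -> 0 <= x -> x <= m * 32 ->
  (m + m) * L - m * delta * x / 1024 <= - (delta * x ^+ 2 / 256 / 256).
Proof.
move=> d0 Lx m0 x0 m2.
have := ler_wpM2l m0 Lx; have := ler_wpM2l (ltW d0) m2.
by move=> /(ler_wpM2r x0); rewrite expr2; lra.
Qed.

Theorem theorem2p6 (R : realType) (p : R) (hp0 : 0 < p) (hp1 : p < 1) :
  exists C c : R, [/\ 1 <= C, 0 < c &
    exists K kappa : R, [/\ 0 < K, 0 < kappa &
      forall (n : nat) (F : 'M[R]_n) (k : nat),
        (2 <= n)%N -> C * ln n%:R <= k%:R -> (k <= n)%N ->
        gnp_prob p (fun G : graph n =>
            sigma (n - k + 1) (laplacian R G + F)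
              <= c * k%:R / Num.sqrt n%:R)
          <= K * expR (- (kappa * (k%:R `^ (3 / 2) / ln n%:R)))]].
Proof.
pose delta := p * (1 - p) / 4.
have d0 : 0 < delta by rewrite divr_gt0 // mulr_gt0 // subr_gt0.
have d1 : delta <= 1 / 16 by have := sqr_ge0 (p - 1 / 2); rewrite /delta expr2; lra.
have ln2 := ln2_ge R.
(* With this [c], the term [m rho / 16] of [small_sigma_prob] is at most a quarter of
   the gain [delta m k / 256]; with [C = 4096 / delta], what is left absorbs the
   [n ^ (2 m)] choices of the selected vertices. *)
have [c c0 cE] : exists2 c : R, 0 < c & c ^+ 2 = delta / 512.
  have h : 0 < delta / 512 by lra.
  by exists (Num.sqrt (delta / 512)); [rewrite sqrtr_gt0; exact: h | exact: sqr_sqrtr (ltW h)].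
have C1 : 1 <= 4096 / delta by rewrite ler_pdivlMr //; lra.
have [kappa kappa0 kappaE] : exists2 kappa, 0 < kappa & kappa = delta * ln 2 / 256 / 256.
  eexists; last reflexivity; have : 0 < delta * ln 2 by apply: mulr_gt0; lra.
  by lra.
exists (4096 / delta), c; split; [exact: C1 | exact: c0 |].
exists 2, kappa; split; [exact: ltr0Sn | exact: kappa0 |] => {C1 kappa0}.
move=> n F k n2 Ck kn; set L := ln n%:R.
have n0 : (0 < n)%N by apply: leq_trans n2.
have nR : (0 : R) < n%:R by rewrite ltr0n.
have L2 : ln 2 <= L by rewrite ler_ln ?posrE ?ler_nat.
have Lk : 4096 * L <= delta * k%:R.
  by move: Ck; rewrite mulrAC ler_pdivrMr // [k%:R * _]mulrC.
have k16 : (16 <= k)%N.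
  rewrite -(ler_nat R); have : delta * k%:R <= 1 / 16 * k%:R by apply: ler_wpM2r.
  lra.
have x16 : (16 : R) <= k%:R by rewrite ler_nat.
(* For [m = k / 16] the dimension [k - 4 m] of the left subspace is at least
   [3 k / 4], and [s = k / 4] quiet vertices leave [k / 2] of it. *)
have [] := quotient_bounds k16.
set m := (k %/ 16)%N; set s := (k %/ 4)%N => m1 m2 s1 s2 mk.
move: m1 m2 s1 s2; rewrite -!(ler_nat R) !natrM -[s.+1%:R]natr1 => m1 m2 s1 s2.
pose t := c * k%:R / Num.sqrt n%:R.
have t0 : 0 <= t by apply: divr_ge0 (sqrtr_ge0 _); apply: mulr_ge0 (ltW c0) (ler0n _ _).
have tn : t ^+ 2 * n%:R = delta / 512 * k%:R ^+ 2.
  rewrite /t expr_div_n exprMn cE (sqr_sqrtr (ltW nR)) mulfVK //.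
  exact: lt0r_neq0.
have p01 : 0 <= p <= 1 by rewrite !ltW.
have rhoE : 4 * t ^+ 2 * n%:R <= delta * k%:R / 64 * (k%:R - (m + m)%:R + 1).
  by rewrite -mulrA tn natrD; apply: rho_bound.
apply: le_trans (small_sigma_prob F s p01 n0 kn mk t0 rhoE) _.
have nX j : n%:R ^+ j = expR (j%:R * L) by rewrite -[n%:R]lnK // expRM_natl.
rewrite -/delta !nX -(expRD (s.+1%:R * L)) -[s.+1%:R]natr1 !natrD.
have m0 := ler0n R m; have s0 := ler0n R s; have x0 := ler0n R k.
have h1 := small_ball_exponent d0 m0 m1 s1; rewrite -ler_expR in h1.
have h2 := quiet_exponent d0 Lk m0 m2 s2 s0 x0; rewrite -ler_expR in h2.
have h3 := union_exponent d0 Lk m0 x0 m2; rewrite -ler_expR in h3.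
apply: le_trans (ler_wpM2l (expR_ge0 _) (lerD h1 h2)) _.
have dbl (u v : R) : expR u * (expR v + expR v) = 2 * expR (u + v) by rewrite expRD; ring.
rewrite dbl; apply: ler_wpM2l; first exact: ler0n.
apply: le_trans h3 _; rewrite ler_expR lerN2 kappaE.
have x1 : 1 <= k%:R :> R by lra.
have := ler_wpM2l (ltW d0) (powR_div_ln_le x1 L2); lra.
Qed.
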